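(* Let $\mathcal C_W$ be the category of finite-dimensional continuous left $W$-modules over $\mathbb C$ with their ($W$-linear, constant) morphisms and tensor product defined by $\Delta_*$. The functors $$\omega_1(V)=V_1,\qquad\omega_\infty(V)=V_\infty$$ are fiber functors on $\mathcal C_W$. They have two natural tensor isomorphisms $$T_{\mathrm{alg}},\,T_{\mathrm{hor}}\colon\omega_1\longrightarrow\omega_\infty,\qquad T_{\mathrm{alg},V}=\operatorname{id}_V,\qquad T_{\mathrm{hor},V}=\rho(C_* ),$$ for $(V,\rho)\in\mathcal C_W$. Here $T_{\mathrm{alg}}$ is supplied by the common constant trivialization, and $T_{\mathrm{hor}}=\operatorname{lc}_\infty\circ\operatorname{ev}_1^{-1}$ is horizontal transport. Their ratio $T_{\mathrm{alg}}^{-1}T_{\mathrm{hor}}$ is the tensor automorphism represented by $C_*$.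
   Context: $W=\mathbb C\langle\!\langle w_1,w_2,\ldots\rangle\!\rangle$ is the weight-completed noncommutative power series algebra, $\operatorname{wt}(w_n)=n$, with coproduct $\Delta_*(w_n)=\sum_{i=0}^nw_i\otimes w_{n-i}$, $w_0=1$. A finite-dimensional $W$-module $(V,\rho)$ is continuous if all terms of sufficiently large weight act by zero. Put $x_W(t)=1+\sum_{m\ge1}w_mt^m$. To $(V,\rho)\in\mathcal C_W$ attach the difference system $Y(q+1)=\rho(x_W(1/q))Y(q)$; $\operatorname{Sol}_+(V)$ is the space of $V$-valued sequences $Y(1),Y(2),\dots$ satisfying it on the positive integers. $V_1$ denotes the fiber at $q=1$ of the constant bundle with fiber $V$ (a copy of $V$), and $V_\infty$ is a second copy of $V$, interpreted as the space of regularized leading coefficients. Let $H_1(M)=\sum_{n=1}^M1/n$, $P_M=x_W(1/M)x_W(1/(M-1))\cdots x_W(1)$, $P_0=1$, and $$C_*=\lim_{M\to\infty}e^{-H_1(M)w_1}P_M\in W,$$ a limit that exists weight by weight (i.e. in each quotient of $W$ by terms of weight $>n$). Define $\operatorname{ev}_1\colon\operatorname{Sol}_+(V)\to V_1$ and $\operatorname{lc}_\infty\colon\operatorname{Sol}_+(V)\to V_\infty$ by $$\operatorname{ev}_1(Y)=Y(1),\qquad\operatorname{lc}_\infty(Y)=\lim_{M\to\infty}e^{-H_1(M)\rho(w_1)}Y(M+1).$$ A fiber functor here is an exact faithful tensor functor to finite-dimensional $\mathbb C$-vector spaces. *)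

(* Defs.v *)
From HB Require Import structures.
From mathcomp Require Import all_boot all_order all_algebra.
From mathcomp Require Import boolp classical_sets functions cardinality fsbigop.
From mathcomp Require Import reals topology normedtype sequences.
From mathcomp.real_closed Require Import complex.

Set Implicit Arguments.
Unset Strict Implicit.
Unset Printing Implicit Defensive.

Import Order.TTheory GRing.Theory Num.Theory numFieldNormedType.Exports.
Import passmx.

Local Open Scope classical_set_scope.
Local Open Scope ring_scope.

(* The letter [k : nat] of a word stands for w_{k+1}. *)
Definition word := seq nat.
Definition wt (u : word) : nat := sumn [seq a.+1 | a <- u].

Lemma wt_cat u v : wt (u ++ v) = (wt u + wt v)%N.
Proof. by rewrite /wt map_cat sumn_cat. Qed.

Fixpoint words_upto (k N : nat) : seq word :=
  if k is k'.+1 then [::] :: [seq a :: u | a <- iota 0 N, u <- words_upto k' N]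
  else [:: [::]].
(* A duplicate-free enumeration of the finitely many words of weight < N. *)
Definition words_below (N : nat) : seq word :=
  undup [seq u <- words_upto N N | (wt u < N)%N].

Lemma mem_words_upto k N (u : word) :
  (size u <= k)%N -> all (fun a => a < N)%N u -> u \in words_upto k N.
Proof.
elim: k u => [|k IH] [|a u] //=; rewrite ltnS => su /andP[aN uN].
rewrite inE; apply/orP; right; apply/allpairsP; exists (a, u) => /=.
by split=> //; [rewrite mem_iota | apply: IH].
Qed.

Lemma mem_words_below N u : (u \in words_below N) = (wt u < N)%N.
Proof.
rewrite mem_undup mem_filter; case: ltnP => //= wN.
have : (size u <= wt u)%N /\ all (fun a => a < N)%N u.
  elim: u wN => [|a u IH] //; rewrite /wt /= => wN.
  have [|su uN] := IH _; first by apply: leq_ltn_trans wN; rewrite leq_addl.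
  split; first by rewrite addSn ltnS (leq_trans su) ?leq_addl.
  by rewrite uN andbT (leq_trans _ wN) // ltnS (leq_trans (leqnSn a)) ?leq_addr.
by case=> su uN; apply: mem_words_upto => //; rewrite (leq_trans su) 1?ltnW.
Qed.

Section LinearFun.
Variables (R : pzRingType) (A B : lmodType R) (f : A -> B).
Hypothesis fl : linear f.
Lemma linD x y : f (x + y) = f x + f y.
Proof. by have := fl 1 x y; rewrite !scale1r. Qed.
Lemma lin0 : f 0 = 0.
Proof. by apply: (addrI (f 0)); rewrite -linD !addr0. Qed.
Lemma linZ a x : f (a *: x) = a *: f x.
Proof. by have := fl a x 0; rewrite lin0 !addr0. Qed.
Lemma lin_sum I (r : seq I) (F : I -> A) :
  f (\sum_(i <- r) F i) = \sum_(i <- r) f (F i).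
Proof. by elim/big_rec2: _ => [|i x y _ <-]; rewrite ?lin0 ?linD. Qed.
End LinearFun.

Section Algebra.
Variable K : fieldType.

(* There are finitely many words of each weight, so an element of the
   weight-completed algebra is an arbitrary family of coefficients. *)
Definition W : Type := word -> K.
HB.instance Definition _ := GRing.Lmodule.copy W (word -> K^o).
Implicit Types (x y z : W) (u v : word).

Lemma addWE x y u : (x + y) u = x u + y u. Proof. by []. Qed.
Lemma oppWE x u : (- x) u = - x u. Proof. by []. Qed.
Lemma scaleWE (a : K) x u : (a *: x) u = a * x u. Proof. by []. Qed.
Lemma sumWE I (r : seq I) P (F : I -> W) u :
  (\sum_(i <- r | P i) F i) u = \sum_(i <- r | P i) F i u.
Proof. by elim/big_rec2: _ => //= i y ? Pi <-. Qed.

Definition Wone : W := fun u => (u == [::])%:R.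
Definition Wmul (x y : W) : W := fun u =>
  \sum_(i < (size u).+1) x (take i u) * y (drop i u).

Let sh (a : nat) (x : W) : W := fun v => x (a :: v).

Lemma Wmul_nil x y : Wmul x y [::] = x [::] * y [::].
Proof. by rewrite /Wmul big_ord_recl big_ord0 addr0. Qed.

Lemma Wmul_cons x y a u :
  Wmul x y (a :: u) = x [::] * y (a :: u) + Wmul (sh a x) y u.
Proof. by rewrite /Wmul big_ord_recl. Qed.

Fact WmulDl : left_distributive Wmul +%R.
Proof.
move=> x y z; apply/funext=> u; rewrite addWE /Wmul -big_split /=.
by apply: eq_bigr => i _; rewrite -mulrDl.
Qed.

Fact WmulDr : right_distributive Wmul +%R.
Proof.
move=> x y z; apply/funext=> u; rewrite addWE /Wmul -big_split /=.
by apply: eq_bigr => i _; rewrite -mulrDr.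
Qed.

Fact WscaleAl (a : K) x y : a *: (Wmul x y) = Wmul (a *: x) y.
Proof.
apply/funext=> u; rewrite scaleWE /Wmul mulr_sumr.
by apply: eq_bigr => i _; rewrite mulrA.
Qed.

Fact WscaleAr (a : K) x y : a *: (Wmul x y) = Wmul x (a *: y).
Proof.
apply/funext=> u; rewrite scaleWE /Wmul mulr_sumr.
by apply: eq_bigr => i _; rewrite mulrCA.
Qed.

Fact WmulA : associative Wmul.
Proof.
move=> x y z; apply/funext=> u; elim: u x y z => [|a u IH] x y z.
  by rewrite !Wmul_nil mulrA.
rewrite !Wmul_cons Wmul_nil IH.
have -> : sh a (Wmul x y) = x [::] *: sh a y + Wmul (sh a x) y.
  by apply/funext=> v; rewrite /sh Wmul_cons.
by rewrite WmulDl -WscaleAl addWE scaleWE addrA mulrDr mulrA.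
Qed.

Fact Wmul1l : left_id Wone Wmul.
Proof.
move=> x; apply/funext=> u; rewrite /Wmul big_ord_recl big1 ?addr0 /=.
  by rewrite take0 drop0 /Wone eqxx mul1r.
move=> i _; rewrite /Wone; case: eqP => [e|]; last by rewrite mul0r.
have := congr1 size e; rewrite size_take /= /bump /= add1n.
by case: ltnP => // _ /eqP; rewrite size_eq0 => /eqP E; case: i e; rewrite E => -[].
Qed.

Fact Wmul1r : right_id Wone Wmul.
Proof.
move=> x; apply/funext=> u; rewrite /Wmul big_ord_recr big1 ?add0r /=.
  by rewrite ?add0r take_size drop_size /Wone eqxx mulr1.
move=> i _; rewrite /Wone; case: eqP => [e|]; last by rewrite mulr0.
have := congr1 size e; rewrite size_drop /= => /eqP; rewrite subn_eq0.
by rewrite leqNgt ltn_ord.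
Qed.

Fact Wone_neq0 : Wone != 0.
Proof. by apply/eqP => /(congr1 (@^~ [::])) /eqP; rewrite /Wone oner_eq0. Qed.

HB.instance Definition _ := GRing.Zmodule_isNzRing.Build W
  WmulA Wmul1l Wmul1r WmulDl WmulDr Wone_neq0.
HB.instance Definition _ := GRing.Lmodule_isLalgebra.Build K W WscaleAl.
HB.instance Definition _ := GRing.Lalgebra_isAlgebra.Build K W WscaleAr.

Definition mon (u : word) : W := fun v => (v == u)%:R.
(* w_ n is w_n, with the convention w_0 = 1. *)
Definition wletter (n : nat) : word := if n is k.+1 then [:: k] else [::].
Definition w_ (n : nat) : W := mon (wletter n).

Lemma w0E : w_ 0 = 1. Proof. by []. Qed.

Lemma monM u v : mon u * mon v = mon (u ++ v).
Proof.
apply/funext=> t.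
change (Wmul (mon u) (mon v) t = mon (u ++ v) t); rewrite /Wmul /mon.
case: (boolP (t == u ++ v)) => [/eqP ->|nt].
  have hs : (size u < (size (u ++ v)).+1)%N by rewrite ltnS size_cat leq_addr.
  rewrite (bigD1 (Ordinal hs)) //= take_size_cat // drop_size_cat // !eqxx mulr1 big1 ?addr0 //.
  move=> i ni; case: eqP => [e|]; last by rewrite mul0r.
  case/eqP: ni; apply: val_inj; rewrite /= -[in RHS]e size_takel //.
  by rewrite -ltnS.
rewrite big1 // => i _; case: eqP => [e1|]; last by rewrite mul0r.
case: eqP => [e2|]; last by rewrite mulr0.
by case/eqP: nt; rewrite -e1 -e2 cat_take_drop.
Qed.

(* x only has terms of weight at least N. *)
Definition high (N : nat) (x : W) := forall u, (wt u < N)%N -> x u = 0.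

Lemma highMl N x y : high N x -> high N (x * y).
Proof.
move=> hx u uN; change (Wmul x y u = 0); rewrite /Wmul big1 // => i _.
rewrite hx ?mul0r //; apply: leq_ltn_trans uN.
by rewrite -[in leqRHS](cat_take_drop i u) wt_cat leq_addr.
Qed.

Lemma highMr N x y : high N y -> high N (x * y).
Proof.
move=> hy u uN; change (Wmul x y u = 0); rewrite /Wmul big1 // => i _.
rewrite hy ?mulr0 //; apply: leq_ltn_trans uN.
by rewrite -[in leqRHS](cat_take_drop i u) wt_cat leq_addl.
Qed.

Definition trunc N x : W := \sum_(u <- words_below N) x u *: mon u.

Lemma truncE N x u : trunc N x u = if (wt u < N)%N then x u else 0.
Proof.
rewrite /trunc sumWE -mem_words_below; case: ifP => uN.
  rewrite (bigD1_seq u) ?undup_uniq //= big1 ?addr0; last first.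
    by move=> v nv; rewrite scaleWE /mon eq_sym (negPf nv) mulr0.
  by rewrite scaleWE /mon eqxx mulr1.
rewrite big_seq big1 // => v vN; rewrite scaleWE /mon; case: eqP => [e|].
  by rewrite e vN in uN.
by rewrite mulr0.
Qed.

Lemma high_trunc N x : high N (x - trunc N x).
Proof. by move=> u uN; rewrite addWE oppWE truncE uN subrr. Qed.

(* The weight-completed tensor square of W. *)
Definition W2 : Type := word * word -> K.
HB.instance Definition _ := GRing.Lmodule.copy W2 (word * word -> K^o).
Implicit Types F G H : W2.

Lemma addW2E F G p : (F + G) p = F p + G p. Proof. by []. Qed.
Lemma oppW2E F p : (- F) p = - F p. Proof. by []. Qed.
Lemma scaleW2E (a : K) F p : (a *: F) p = a * F p. Proof. by []. Qed.
Lemma sumW2E I (r : seq I) P (F : I -> W2) p :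
  (\sum_(i <- r | P i) F i) p = \sum_(i <- r | P i) F i p.
Proof. by elim/big_rec2: _ => //= i y ? Pi <-. Qed.

Definition wtens (x y : W) : W2 := fun p => x p.1 * y p.2.
Definition W2mul (F G : W2) : W2 := fun p =>
  \sum_(i < (size p.1).+1) \sum_(j < (size p.2).+1)
    F (take i p.1, take j p.2) * G (drop i p.1, drop j p.2).

(* Delta_* is the continuous algebra morphism with
   Delta_*(w_n) = \sum_i w_i (x) w_{n-i}.  For given p, only the words u with
   wt u = wt p.1 + wt p.2 contribute to the sum in coprod. *)
Definition coprod_letter (n : nat) : W2 :=
  \sum_(i < n.+1) wtens (w_ i) (w_ (n - i)).
Fixpoint coprod_word (u : word) : W2 :=
  if u is k :: u' then W2mul (coprod_letter k.+1) (coprod_word u')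
  else wtens 1 1.
Definition coprod (x : W) : W2 := fun p =>
  \sum_(u \in [set: word]) x u * coprod_word u p.

Lemma wletter_wt n : wt (wletter n) = n.
Proof. by case: n => //= n; rewrite /wt /= addn0. Qed.

Lemma coprod_letter_wt n p :
  (wt p.1 + wt p.2)%N <> n -> coprod_letter n p = 0.
Proof.
move=> np; rewrite /coprod_letter sumW2E big1 // => i _.
rewrite /wtens /w_ /mon; case: eqP => [e1|]; last by rewrite mul0r.
case: eqP => [e2|]; last by rewrite mulr0.
by case: np; rewrite e1 e2 !wletter_wt subnKC // -ltnS.
Qed.

Lemma coprod_word_wt u p :
  (wt p.1 + wt p.2)%N <> wt u -> coprod_word u p = 0.
Proof.
elim: u p => [|k u IH] [p1 p2] /= np.
  rewrite /wtens /=; case: p1 np => [|a p1] np.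
    case: p2 np => [|b p2] np; first by case: np.
    by rewrite [X in _ * X]/(Wone _) /Wone mulr0.
  by rewrite [X in X * _]/(Wone _) /Wone mul0r.
rewrite /W2mul /= big1 // => i _; rewrite big1 // => j _.
case: (@eqP _ (wt (take i p1) + wt (take j p2))%N k.+1) => [e|ne]; last first.
  by rewrite coprod_letter_wt ?mul0r.
rewrite IH ?mulr0 //= => e2; case: np.
have w1 := wt_cat (take i p1) (drop i p1); have w2 := wt_cat (take j p2) (drop j p2).
rewrite !cat_take_drop in w1 w2; rewrite w1 w2 addnACA.
by rewrite e e2.
Qed.

Lemma coprodE N x p : (wt p.1 + wt p.2 < N)%N ->
  coprod x p = \sum_(u <- words_below N) x u * coprod_word u p.
Proof.
move=> pN; rewrite /coprod.
rewrite (fsbigE (words_below N)) ?undup_uniq //.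
  by apply: eq_bigl => u; rewrite in_setT.
move=> u _ nu; rewrite coprod_word_wt ?mulr0 // => e.
by case/negP: nu; rewrite mem_words_below -e.
Qed.

Definition mon2 (q : word * word) : W2 := fun p => (p == q)%:R.
Definition high2 N (F : W2) :=
  forall p, (wt p.1 < N)%N -> (wt p.2 < N)%N -> F p = 0.

Lemma wtens_mon u v : wtens (mon u) (mon v) = mon2 (u, v).
Proof.
by apply/funext=> -[p1 p2]; rewrite /wtens /mon /mon2 /= -natrM mulnb xpair_eqE.
Qed.

Lemma W2mulDl F G H : W2mul (F + G) H = W2mul F H + W2mul G H.
Proof.
apply/funext=> p; rewrite addW2E /W2mul -big_split /=; apply: eq_bigr => i _.
by rewrite -big_split /=; apply: eq_bigr => j _; rewrite -mulrDl.
Qed.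
Lemma W2mulDr F G H : W2mul H (F + G) = W2mul H F + W2mul H G.
Proof.
apply/funext=> p; rewrite addW2E /W2mul -big_split /=; apply: eq_bigr => i _.
by rewrite -big_split /=; apply: eq_bigr => j _; rewrite -mulrDr.
Qed.
Lemma W2mulZr a F G : W2mul F (a *: G) = a *: W2mul F G.
Proof.
apply/funext=> p; rewrite scaleW2E /W2mul mulr_sumr; apply: eq_bigr => i _.
by rewrite mulr_sumr; apply: eq_bigr => j _; rewrite mulrCA.
Qed.
Lemma W2mul0l G : W2mul 0 G = 0.
Proof.
by apply/funext=> p; rewrite /W2mul big1 // => i _; rewrite big1 // => j _;
   rewrite mul0r.
Qed.
Lemma W2mul0r G : W2mul G 0 = 0.
Proof.
by apply/funext=> p; rewrite /W2mul big1 // => i _; rewrite big1 // => j _;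
   rewrite mulr0.
Qed.

Lemma mon2M q r : W2mul (mon2 q) (mon2 r) = mon2 (q.1 ++ r.1, q.2 ++ r.2).
Proof.
case: q r => [q1 q2] [r1 r2] /=; rewrite -!wtens_mon -!monM.
apply/funext=> -[p1 p2]; rewrite /wtens /W2mul /=.
rewrite -[in RHS]/(Wmul _ _ _ * Wmul _ _ _) /Wmul big_distrlr /=.
by apply: eq_bigr => i _; apply: eq_bigr => j _; rewrite mulrACA.
Qed.

Lemma high2M N q F : high2 N F -> high2 N (W2mul (mon2 q) F).
Proof.
move=> hF [p1 p2] /= h1 h2; rewrite /W2mul big1 // => i _; rewrite big1 // => j _.
rewrite hF ?mulr0 //=.
  by apply: leq_ltn_trans h1; rewrite -[in leqRHS](cat_take_drop i p1) wt_cat leq_addl.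
by apply: leq_ltn_trans h2; rewrite -[in leqRHS](cat_take_drop j p2) wt_cat leq_addl.
Qed.

End Algebra.

Section Tensor.
Variable K : fieldType.
Implicit Types T U V : vectType K.

(* V1 (x) V2 is realised by coordinate matrices, v1 (x) v2 being a matrix of
   rank at most one; tliftE and tens_ext are its universal property. *)
Definition tensv V1 V2 : vectType K := 'M[K]_(\dim {:V1}, \dim {:V2}).

Definition bilin V1 V2 U (b : V1 -> V2 -> U) :=
  (forall v2, linear (b^~ v2)) /\ (forall v1, linear (b v1)).

Section TwoSpaces.
Variables V1 V2 U : vectType K.
Let e1 := vbasis {:V1}.
Let e2 := vbasis {:V2}.

Definition tens (v1 : V1) (v2 : V2) : tensv V1 V2 := (rVof e1 v1)^T *m rVof e2 v2.

Definition tlift_fun (b : V1 -> V2 -> U) (X : tensv V1 V2) : U :=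
  \sum_(i < \dim {:V1}) \sum_(j < \dim {:V2}) (X : 'M_(_, _)) i j *: b e1`_i e2`_j.

Fact tlift_fun_linear b : linear (tlift_fun b).
Proof.
move=> a X Y; rewrite /tlift_fun scaler_sumr -big_split /=; apply: eq_bigr => i _.
rewrite scaler_sumr -big_split /=; apply: eq_bigr => j _.
by rewrite !mxE scalerDl scalerA.
Qed.
HB.instance Definition _ b := GRing.isSemilinear.Build K _ _ _ (tlift_fun b)
  (GRing.semilinear_linear (tlift_fun_linear b)).

Definition tlift b : 'Hom(tensv V1 V2, U) := linfun (tlift_fun b).

Lemma tens_bilin : bilin tens.
Proof.
split=> v a x y; rewrite /tens.
  by rewrite linearP /= linearP /= mulmxDl scalemxAl.
by rewrite linearP /= mulmxDr scalemxAr.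
Qed.

Lemma tliftE b v1 v2 : bilin b -> tlift b (tens v1 v2) = b v1 v2.
Proof.
case=> bl br; rewrite lfunE /= /tlift_fun.
pose bL w := linfun (HB.pack (b^~ w) (GRing.isLinear.Build _ _ _ _ _ (bl w))
   : {linear V1 -> U}).
pose bR w := linfun (HB.pack (b w) (GRing.isLinear.Build _ _ _ _ _ (br w))
   : {linear V2 -> U}).
have bLE w x : bL w x = b x w by rewrite lfunE.
have bRE w x : bR w x = b w x by rewrite lfunE.
have E1 := coord_basis (vbasisP {:V1}) (memvf v1).
have E2 := coord_basis (vbasisP {:V2}) (memvf v2).
rewrite -bLE {2}E1 linear_sum /=; apply: eq_bigr => i _.
rewrite linearZ /= bLE -bRE {2}E2 linear_sum /= scaler_sumr.
apply: eq_bigr => j _; rewrite linearZ /= bRE scalerA; congr (_ *: _).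
by rewrite /tens mxE big_ord_recl big_ord0 addr0 !mxE.
Qed.

Lemma tens_ext (f g : 'Hom(tensv V1 V2, U)) :
  (forall v1 v2, f (tens v1 v2) = g (tens v1 v2)) -> f = g.
Proof.
move=> fg; apply/lfunP => X.
have -> : X = \sum_i \sum_j (X : 'M_(_, _)) i j *: tens e1`_i e2`_j.
  rewrite {1}[X]matrix_sum_delta; apply: eq_bigr => i _; apply: eq_bigr => j _.
  congr (_ *: _); rewrite /tens !rVofE ?vbasisP //.
  by rewrite trmx_delta mul_delta_mx.
rewrite !linear_sum; apply: eq_bigr => i _; rewrite !linear_sum; apply: eq_bigr => j _.
by rewrite !linearZ /= fg.
Qed.

End TwoSpaces.

Section BilinTheory.
Variables (V1 V2 U : vectType K) (b : V1 -> V2 -> U).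
Hypothesis hb : bilin b.
Lemma bilin0l z : b 0 z = 0. Proof. exact: (lin0 (hb.1 z)). Qed.
Lemma bilin0r z : b z 0 = 0. Proof. exact: (lin0 (hb.2 z)). Qed.
Lemma bilinZl a x z : b (a *: x) z = a *: b x z.
Proof. exact: (linZ (hb.1 z)). Qed.
Lemma bilinZr a x z : b z (a *: x) = a *: b z x.
Proof. exact: (linZ (hb.2 z)). Qed.
Lemma bilin_suml I (r : seq I) (F : I -> V1) z :
  b (\sum_(i <- r) F i) z = \sum_(i <- r) b (F i) z.
Proof. exact: (lin_sum (hb.1 z)). Qed.
Lemma bilin_sumr I (r : seq I) (F : I -> V2) z :
  b z (\sum_(i <- r) F i) = \sum_(i <- r) b z (F i).
Proof. exact: (lin_sum (hb.2 z)). Qed.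
End BilinTheory.

Definition tmap V1 U1 V2 U2 (f : 'Hom(V1, U1)) (g : 'Hom(V2, U2)) :
    'Hom(tensv V1 V2, tensv U1 U2) := tlift (fun v1 v2 => tens (f v1) (g v2)).

Lemma tmapE V1 V2 U1 U2 (f : 'Hom(V1, U1)) (g : 'Hom(V2, U2)) v1 v2 :
  tmap f g (tens v1 v2) = tens (f v1) (g v2).
Proof.
rewrite tliftE //; split=> v a x y; rewrite linearP.
  by rewrite (tens_bilin _ _).1.
by rewrite (tens_bilin _ _).2.
Qed.

Lemma tmap_comp V1 V2 U1 U2 T1 T2 (f : 'Hom(V1, U1)) (g : 'Hom(V2, U2))
    (f' : 'Hom(U1, T1)) (g' : 'Hom(U2, T2)) :
  tmap (f' \o f)%VF (g' \o g)%VF = (tmap f' g' \o tmap f g)%VF.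
Proof. by apply: tens_ext => v1 v2; rewrite comp_lfunE !tmapE !comp_lfunE. Qed.

Lemma tmap1 V1 V2 : tmap (\1%VF : 'End(V1)) (\1%VF : 'End(V2)) = \1%VF.
Proof. by apply: tens_ext => v1 v2; rewrite !tmapE !id_lfunE. Qed.

Lemma tmap_bilin V1 U1 V2 U2 : bilin (@tmap V1 U1 V2 U2).
Proof.
split=> g a f f'; apply: tens_ext => v1 v2;
  rewrite add_lfunE scale_lfunE !tmapE add_lfunE scale_lfunE.
  by rewrite (tens_bilin _ _).1.
by rewrite (tens_bilin _ _).2.
Qed.

Lemma tens3_ext V1 V2 V3 U (f g : 'Hom(tensv (tensv V1 V2) V3, U)) :
  (forall x y z, f (tens (tens x y) z) = g (tens (tens x y) z)) -> f = g.
Proof.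
move=> fg; apply: tens_ext => t z.
have h (k : 'Hom(tensv (tensv V1 V2) V3, U)) : linear (fun t => k (tens t z)).
  by move=> a x y; rewrite (tens_bilin _ _).1 linearP.
pose L (k : 'Hom(tensv (tensv V1 V2) V3, U)) :=
  linfun (HB.pack (fun t => k (tens t z)) (GRing.isLinear.Build _ _ _ _ _ (h k))
    : {linear tensv V1 V2 -> U}).
have LE k s : L k s = k (tens s z) by rewrite lfunE.
by rewrite -!LE; congr (fun_of_lfun _ _); apply: tens_ext => x y; rewrite !LE.
Qed.

Lemma tens3r_ext V1 V2 V3 U (f g : 'Hom(tensv V1 (tensv V2 V3), U)) :
  (forall x y z, f (tens x (tens y z)) = g (tens x (tens y z))) -> f = g.
Proof.
move=> fg; apply: tens_ext => z t.
have h (k : 'Hom(tensv V1 (tensv V2 V3), U)) : linear (fun t => k (tens z t)).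
  by move=> a x y; rewrite (tens_bilin _ _).2 linearP.
pose L (k : 'Hom(tensv V1 (tensv V2 V3), U)) :=
  linfun (HB.pack (fun t => k (tens z t)) (GRing.isLinear.Build _ _ _ _ _ (h k))
    : {linear tensv V2 V3 -> U}).
have LE k s : L k s = k (tens z s) by rewrite lfunE.
by rewrite -!LE; congr (fun_of_lfun _ _); apply: tens_ext => x y; rewrite !LE.
Qed.

Lemma tens4_ext V1 V2 V3 V4 U (f g : 'Hom(tensv (tensv (tensv V1 V2) V3) V4, U)) :
  (forall x y z t, f (tens (tens (tens x y) z) t) = g (tens (tens (tens x y) z) t)) ->
  f = g.
Proof.
move=> fg; apply: tens_ext => s t.
have h (k : 'Hom(tensv (tensv (tensv V1 V2) V3) V4, U)) : linear (fun s => k (tens s t)).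
  by move=> a x y; rewrite (tens_bilin _ _).1 linearP.
pose L (k : 'Hom(tensv (tensv (tensv V1 V2) V3) V4, U)) :=
  linfun (HB.pack (fun s => k (tens s t)) (GRing.isLinear.Build _ _ _ _ _ (h k))
    : {linear tensv (tensv V1 V2) V3 -> U}).
have LE k r : L k r = k (tens r t) by rewrite lfunE.
by rewrite -!LE; congr (fun_of_lfun _ _); apply: tens3_ext => x y z; rewrite !LE.
Qed.

Section Constraints.
Variables V1 V2 V3 : vectType K.

Definition tassoc : 'Hom(tensv (tensv V1 V2) V3, tensv V1 (tensv V2 V3)) :=
  tlift (fun t z => tlift (fun x y => tens x (tens y z)) t).
Definition tassoc_inv : 'Hom(tensv V1 (tensv V2 V3), tensv (tensv V1 V2) V3) :=
  tlift (fun x t => tlift (fun y z => tens (tens x y) z) t).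
Definition tlunit : 'Hom(tensv K^o V1, V1) := tlift (fun (a : K^o) v => (a : K) *: v).
Definition tlunit_inv : 'Hom(V1, tensv K^o V1) :=
  linfun (fun v => tens (1 : K^o) v).
Definition trunit : 'Hom(tensv V1 K^o, V1) := tlift (fun v (a : K^o) => (a : K) *: v).
Definition trunit_inv : 'Hom(V1, tensv V1 K^o) :=
  linfun (fun v => tens v (1 : K^o)).
Definition tbraid : 'Hom(tensv V1 V2, tensv V2 V1) :=
  tlift (fun x y => tens y x).

Lemma tassocE x y z : tassoc (tens (tens x y) z) = tens x (tens y z).
Proof.
have h v : bilin (fun (x : V1) (y : V2) => tens x (tens y (v : V3))).
  split=> w a s t; first by rewrite (tens_bilin _ _).1.
  by rewrite (tens_bilin _ _).1 (tens_bilin _ _).2.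
rewrite tliftE ?tliftE //; split=> w a s t; first by rewrite linearP.
suff -> : tlift (fun x y => tens x (tens y (a *: s + t))) =
  a *: tlift (fun (x : V1) (y : V2) => tens x (tens y s)) +
       tlift (fun x y => tens x (tens y t)) by rewrite add_lfunE scale_lfunE.
apply: tens_ext => v1 v2; rewrite add_lfunE scale_lfunE !tliftE //.
by rewrite !(tens_bilin _ _).2.
Qed.

Lemma tassoc_invE x y z : tassoc_inv (tens x (tens y z)) = tens (tens x y) z.
Proof.
have h v : bilin (fun (y : V2) (z : V3) => tens (tens (v : V1) y) z).
  split=> w a s t; first by rewrite (tens_bilin _ _).2 (tens_bilin _ _).1.
  by rewrite (tens_bilin _ _).2.
rewrite tliftE ?tliftE //; split=> w a s t; last by rewrite linearP.
suff -> : tlift (fun y z => tens (tens (a *: s + t) y) z) =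
  a *: tlift (fun (y : V2) (z : V3) => tens (tens s y) z) +
       tlift (fun y z => tens (tens t y) z) by rewrite add_lfunE scale_lfunE.
apply: tens_ext => v1 v2; rewrite add_lfunE scale_lfunE !tliftE //.
by rewrite !(tens_bilin _ _).1.
Qed.

Lemma tlunitE (a : K^o) v : tlunit (tens a v) = (a : K) *: v.
Proof.
rewrite tliftE //; split=> w b s t; last by rewrite linearP.
by rewrite scalerDl -scalerA.
Qed.
Lemma trunitE v (a : K^o) : trunit (tens v a) = (a : K) *: v.
Proof.
rewrite tliftE //; split=> w b s t; first by rewrite linearP.
by rewrite scalerDl -scalerA.
Qed.
Lemma tlunit_invE v : tlunit_inv v = tens (1 : K^o) v.
Proof.
pose L := (HB.pack (fun v => tens (1 : K^o) v)
  (GRing.isLinear.Build _ _ _ _ _ ((tens_bilin K^o V1).2 1)) : {linear V1 -> _}).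
exact: (lfunE L).
Qed.
Lemma trunit_invE v : trunit_inv v = tens v (1 : K^o).
Proof.
pose L := (HB.pack (fun v => tens v (1 : K^o))
  (GRing.isLinear.Build _ _ _ _ _ ((tens_bilin V1 K^o).1 1)) : {linear V1 -> _}).
exact: (lfunE L).
Qed.
Lemma tbraidE x y : tbraid (tens x y) = tens y x.
Proof.
by rewrite tliftE //; split=> w a s t; rewrite ?(tens_bilin _ _).1 ?(tens_bilin _ _).2.
Qed.
End Constraints.
End Tensor.

Section Category.
Variable K : fieldType.

Record lincat := Lincat {
  ob :> Type;
  hom : ob -> ob -> lmodType K;
  idm : forall A, hom A A;
  comp : forall A B C, hom B C -> hom A B -> hom A C;
  compA : forall A B C D (h : hom C D) (g : hom B C) (f : hom A B),
    comp h (comp g f) = comp (comp h g) f;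
  comp1m : forall A B (f : hom A B), comp (idm B) f = f;
  compm1 : forall A B (f : hom A B), comp f (idm A) = f;
  comp_linl : forall A B C (f : hom A B) a (g g' : hom B C),
    comp (a *: g + g') f = a *: comp g f + comp g' f;
  comp_linr : forall A B C (g : hom B C) a (f f' : hom A B),
    comp g (a *: f + f') = a *: comp g f + comp g f'
}.

Arguments hom {l}.
Arguments idm {l}.
Arguments comp {l A B C}.

Definition inverse_of (C : lincat) (A B : C) (f : hom A B) (g : hom B A) :=
  comp g f = idm A /\ comp f g = idm B.

(* K-linear symmetric monoidal categories. *)
Record tensor_category := TensorCategory {
  tc_cat :> lincat;
  tob : tc_cat -> tc_cat -> tc_cat;
  tmor : forall A A' B B' : tc_cat,
    hom A A' -> hom B B' -> hom (tob A B) (tob A' B');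
  tone : tc_cat;
  assoc : forall A B C : tc_cat, hom (tob (tob A B) C) (tob A (tob B C));
  assoc_inv : forall A B C : tc_cat, hom (tob A (tob B C)) (tob (tob A B) C);
  lunit : forall A : tc_cat, hom (tob tone A) A;
  lunit_inv : forall A : tc_cat, hom A (tob tone A);
  runit : forall A : tc_cat, hom (tob A tone) A;
  runit_inv : forall A : tc_cat, hom A (tob A tone);
  braid : forall A B : tc_cat, hom (tob A B) (tob B A);
  tmor1 : forall A B : tc_cat, tmor (idm A) (idm B) = idm (tob A B);
  tmor_comp : forall (A A' A'' B B' B'' : tc_cat)
      (f' : hom A' A'') (f : hom A A') (g' : hom B' B'') (g : hom B B'),
    tmor (comp f' f) (comp g' g) = comp (tmor f' g') (tmor f g);
  tmor_linl : forall (A A' B B' : tc_cat) (g : hom B B') a (f f' : hom A A'),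
    tmor (a *: f + f') g = a *: tmor f g + tmor f' g;
  tmor_linr : forall (A A' B B' : tc_cat) (f : hom A A') a (g g' : hom B B'),
    tmor f (a *: g + g') = a *: tmor f g + tmor f g';
  assoc_nat : forall (A A' B B' C C' : tc_cat)
      (f : hom A A') (g : hom B B') (h : hom C C'),
    comp (assoc A' B' C') (tmor (tmor f g) h)
      = comp (tmor f (tmor g h)) (assoc A B C);
  assocK : forall A B C : tc_cat, inverse_of (assoc A B C) (assoc_inv A B C);
  lunit_nat : forall (A A' : tc_cat) (f : hom A A'),
    comp (lunit A') (tmor (idm tone) f) = comp f (lunit A);
  lunitK : forall A : tc_cat, inverse_of (lunit A) (lunit_inv A);
  runit_nat : forall (A A' : tc_cat) (f : hom A A'),
    comp (runit A') (tmor f (idm tone)) = comp f (runit A);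
  runitK : forall A : tc_cat, inverse_of (runit A) (runit_inv A);
  braid_nat : forall (A A' B B' : tc_cat) (f : hom A A') (g : hom B B'),
    comp (braid A' B') (tmor f g) = comp (tmor g f) (braid A B);
  braidK : forall A B : tc_cat, comp (braid B A) (braid A B) = idm (tob A B);
  pentagon : forall A B C D : tc_cat,
    comp (assoc A B (tob C D)) (assoc (tob A B) C D)
      = comp (tmor (idm A) (assoc B C D))
          (comp (assoc A (tob B C) D) (tmor (assoc A B C) (idm D)));
  triangle : forall A B : tc_cat,
    comp (tmor (idm A) (lunit B)) (assoc A tone B) = tmor (runit A) (idm B);
  hexagon : forall A B C : tc_cat,
    comp (assoc B C A) (comp (braid A (tob B C)) (assoc A B C))
      = comp (tmor (idm B) (braid A C))
          (comp (assoc B A C) (tmor (braid A B) (idm C)))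
}.

Arguments tob {t}.
Arguments tmor {t A A' B B'}.
Arguments tone {t}.
Arguments assoc {t}.
Arguments lunit {t}.
Arguments runit {t}.
Arguments braid {t}.

Definition is_kernel (C : lincat) (A B D : C) (k : hom A B) (f : hom B D) :=
  comp f k = 0 /\
  forall (X : C) (h : hom X B), comp f h = 0 -> exists! h', comp k h' = h.
Definition is_cokernel (C : lincat) (A B D : C) (f : hom A B) (c : hom B D) :=
  comp c f = 0 /\
  forall (X : C) (h : hom B X), comp h f = 0 -> exists! h', comp h' c = h.
(* In an abelian category these are exactly the short exact sequences
   0 -> A -> B -> D -> 0. *)
Definition short_exact (C : lincat) (A B D : C) (f : hom A B) (g : hom B D) :=
  is_kernel f g /\ is_cokernel f g.

Record tensor_functor_data (C D : tensor_category) := TensorFunctorData {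
  fob :> C -> D;
  fmor : forall A B : C, hom A B -> hom (fob A) (fob B);
  fmu : forall A B : C, hom (tob (fob A) (fob B)) (fob (tob A B));
  feps : hom tone (fob tone)
}.
Arguments fmor {C D} t {A B}.

Section Functors.
Variables C D : tensor_category.
Implicit Types F G : tensor_functor_data C D.

Definition is_linear_functor F :=
  [/\ forall A : C, fmor F (idm A) = idm (F A),
      forall (A B E : C) (g : hom B E) (f : hom A B),
        fmor F (comp g f) = comp (fmor F g) (fmor F f)
    & forall (A B : C) a (f g : hom A B),
        fmor F (a *: f + g) = a *: fmor F f + fmor F g].

Definition is_iso (A B : D) (f : hom A B) := exists g, inverse_of f g.

(* Strong symmetric monoidal K-linear functors. *)
Definition is_tensor_functor F :=
  [/\ is_linear_functor F
        /\ (forall A B, is_iso (fmu F A B)) /\ is_iso (feps F),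
      forall (A A' B B' : C) (f : hom A A') (g : hom B B'),
        comp (fmu F A' B') (tmor (fmor F f) (fmor F g))
          = comp (fmor F (tmor f g)) (fmu F A B),
      forall A B E : C,
        comp (fmor F (assoc A B E))
             (comp (fmu F (tob A B) E) (tmor (fmu F A B) (idm (F E))))
          = comp (fmu F A (tob B E))
                 (comp (tmor (idm (F A)) (fmu F B E)) (assoc (F A) (F B) (F E))),
      forall A : C,
        comp (fmor F (lunit A)) (comp (fmu F tone A) (tmor (feps F) (idm (F A))))
          = lunit (F A) /\
        comp (fmor F (runit A)) (comp (fmu F A tone) (tmor (idm (F A)) (feps F)))
          = runit (F A)
    & forall A B : C,
        comp (fmor F (braid A B)) (fmu F A B) = comp (fmu F B A) (braid (F A) (F B))].

Definition is_faithful F :=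
  forall (A B : C) (f g : hom A B), fmor F f = fmor F g -> f = g.

(* Additivity is part of is_linear_functor. *)
Definition is_exact F :=
  forall (A B E : C) (f : hom A B) (g : hom B E),
    short_exact f g -> short_exact (fmor F f) (fmor F g).

Definition is_tensor_iso F G (T : forall A : C, hom (F A) (G A)) :=
  [/\ forall (A B : C) (f : hom A B), comp (T B) (fmor F f) = comp (fmor G f) (T A),
      forall A : C, is_iso (T A),
      forall A B : C,
        comp (T (tob A B)) (fmu F A B) = comp (fmu G A B) (tmor (T A) (T B))
    & comp (T tone) (feps F) = feps G].

End Functors.

Lemma tpentagon (A B C D : vectType K) :
  (tassoc A B (tensv C D) \o tassoc (tensv A B) C D)%VF
  = (tmap (\1%VF : 'End(A)) (tassoc B C D) \o
      (tassoc A (tensv B C) D \o tmap (tassoc A B C) (\1%VF : 'End(D))))%VF.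
Proof.
apply: tens4_ext => x y z t.
by rewrite !comp_lfunE !tassocE !tmapE !id_lfunE !tassocE !tmapE tassocE !id_lfunE.
Qed.

Lemma ttriangle (A B : vectType K) :
  (tmap (\1%VF : 'End(A)) (tlunit B) \o tassoc A K^o B)%VF
  = tmap (trunit A) (\1%VF : 'End(B)).
Proof.
apply: tens3_ext => x a y.
rewrite !comp_lfunE !tassocE !tmapE !id_lfunE tlunitE trunitE.
by rewrite (bilinZl (tens_bilin _ _)) (bilinZr (tens_bilin _ _)).
Qed.

Lemma thexagon (A B C : vectType K) :
  (tassoc B C A \o (tbraid A (tensv B C) \o tassoc A B C))%VF
  = (tmap (\1%VF : 'End(B)) (tbraid A C) \o
      (tassoc B A C \o tmap (tbraid A B) (\1%VF : 'End(C))))%VF.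
Proof.
apply: tens3_ext => x y z.
by rewrite !comp_lfunE !tassocE !tmapE !tbraidE !id_lfunE !tassocE !tmapE tbraidE id_lfunE.
Qed.

Lemma tassoc_nat (A A' B B' C C' : vectType K)
    (f : 'Hom(A, A')) (g : 'Hom(B, B')) (h : 'Hom(C, C')) :
  (tassoc A' B' C' \o tmap (tmap f g) h)%VF
  = (tmap f (tmap g h) \o tassoc A B C)%VF.
Proof.
by apply: tens3_ext => x y z; rewrite !comp_lfunE !tassocE !tmapE tassocE.
Qed.

Lemma tassocK (A B C : vectType K) :
  (tassoc_inv A B C \o tassoc A B C)%VF = \1%VF /\
  (tassoc A B C \o tassoc_inv A B C)%VF = \1%VF.
Proof.
split; first by apply: tens3_ext => x y z; rewrite comp_lfunE tassocE tassoc_invE id_lfunE.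
by apply: tens3r_ext => x y z; rewrite comp_lfunE tassoc_invE tassocE id_lfunE.
Qed.

Lemma tlunit_nat (A A' : vectType K) (f : 'Hom(A, A')) :
  (tlunit A' \o tmap (\1%VF : 'End(K^o)) f)%VF = (f \o tlunit A)%VF.
Proof.
apply: tens_ext => a x.
by rewrite !comp_lfunE !tmapE !tlunitE id_lfunE linearZ.
Qed.

Lemma trunit_nat (A A' : vectType K) (f : 'Hom(A, A')) :
  (trunit A' \o tmap f (\1%VF : 'End(K^o)))%VF = (f \o trunit A)%VF.
Proof.
apply: tens_ext => a x.
by rewrite !comp_lfunE !tmapE !trunitE id_lfunE linearZ.
Qed.

Lemma tlunitK (A : vectType K) :
  (tlunit_inv A \o tlunit A)%VF = \1%VF /\ (tlunit A \o tlunit_inv A)%VF = \1%VF.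
Proof.
split; last first.
  by apply/lfunP => x; rewrite comp_lfunE tlunit_invE tlunitE scale1r id_lfunE.
apply: tens_ext => a x; rewrite comp_lfunE tlunitE tlunit_invE id_lfunE.
rewrite (bilinZr (tens_bilin _ _)) -(bilinZl (tens_bilin _ _)).
by congr (tens _ _); rewrite /GRing.scale /= mulr1.
Qed.

Lemma trunitK (A : vectType K) :
  (trunit_inv A \o trunit A)%VF = \1%VF /\ (trunit A \o trunit_inv A)%VF = \1%VF.
Proof.
split; last first.
  by apply/lfunP => x; rewrite comp_lfunE trunit_invE trunitE scale1r id_lfunE.
apply: tens_ext => x a; rewrite comp_lfunE trunitE trunit_invE id_lfunE.
rewrite (bilinZl (tens_bilin _ _)) -(bilinZr (tens_bilin _ _)).
by congr (tens _ _); rewrite /GRing.scale /= mulr1.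
Qed.

Lemma tbraid_nat (A A' B B' : vectType K) (f : 'Hom(A, A')) (g : 'Hom(B, B')) :
  (tbraid A' B' \o tmap f g)%VF = (tmap g f \o tbraid A B)%VF.
Proof. by apply: tens_ext => x y; rewrite !comp_lfunE !tmapE !tbraidE tmapE. Qed.

Lemma tbraidK (A B : vectType K) : (tbraid B A \o tbraid A B)%VF = \1%VF.
Proof. by apply: tens_ext => x y; rewrite !comp_lfunE !tbraidE id_lfunE. Qed.

Lemma vect_comp_linl (A B C : vectType K) (f : 'Hom(A, B)) a (g g' : 'Hom(B, C)) :
  ((a *: g + g') \o f = a *: (g \o f) + (g' \o f))%VF.
Proof. by rewrite comp_lfunDl comp_lfunZl. Qed.

Lemma vect_comp_linr (A B C : vectType K) (g : 'Hom(B, C)) a (f f' : 'Hom(A, B)) :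
  (g \o (a *: f + f') = a *: (g \o f) + (g \o f'))%VF.
Proof. by rewrite comp_lfunDr comp_lfunZr. Qed.

Definition vect_cat : lincat :=
  @Lincat (vectType K) (fun V U => 'Hom(V, U) : lmodType K)
    (fun V => \1%VF) (fun V U T g f => (g \o f)%VF)
    (fun A B C D h g f => comp_lfunA h g f)
    (fun A B f => comp_lfun1l f) (fun A B f => comp_lfun1r f)
    vect_comp_linl vect_comp_linr.

Definition Vect : tensor_category := @TensorCategory vect_cat
  (@tensv K) (@tmap K) (K^o : vectType K)
  (@tassoc K) (@tassoc_inv K) (@tlunit K) (@tlunit_inv K) (@trunit K)
  (@trunit_inv K) (@tbraid K)
  (@tmap1 K) (fun A A' A'' B B' B'' f' f g' g => tmap_comp f g f' g')
  (fun A A' B B' g => (tmap_bilin A A' B B').1 g)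
  (fun A A' B B' f => (tmap_bilin A A' B B').2 f)
  tassoc_nat tassocK tlunit_nat tlunitK trunit_nat trunitK tbraid_nat tbraidK
  tpentagon ttriangle thexagon.

End Category.

Lemma comp_sumr (K : fieldType) (A B C : vectType K) (g : 'Hom(B, C)) I (r : seq I)
    (F : I -> 'Hom(A, B)) :
  (g \o \sum_(i <- r) F i)%VF = \sum_(i <- r) (g \o F i)%VF.
Proof. by elim/big_rec2: _ => [|i x y _ <-]; rewrite ?comp_lfun0r ?comp_lfunDr. Qed.
Lemma comp_suml (K : fieldType) (A B C : vectType K) (g : 'Hom(A, B)) I (r : seq I)
    (F : I -> 'Hom(B, C)) :
  ((\sum_(i <- r) F i) \o g)%VF = \sum_(i <- r) (F i \o g)%VF.
Proof. by elim/big_rec2: _ => [|i x y _ <-]; rewrite ?comp_lfun0l ?comp_lfunDl. Qed.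

Section Modules.
Variable K : fieldType.
Implicit Types (x y : W K) (u v : word).

(* Finite-dimensional continuous left W-modules. *)
Record wmod := WMod {
  wsp :> vectType K;
  rho : W K -> 'End(wsp);
  rho_linear : linear rho;
  rho1 : rho 1 = \1%VF;
  rhoM : forall x y, rho (x * y) = (rho x \o rho y)%VF;
  rho_continuous : exists N, forall x, high N x -> rho x = 0
}.

Section Reps.
Variables (U : vectType K).

Lemma linear_trunc (r : W K -> 'End(U)) N x : linear r ->
  (forall x, high N x -> r x = 0) ->
  r x = \sum_(u <- words_below N) x u *: r (mon K u).
Proof.
move=> rl rN; have ex : x = trunc N x + (x - trunc N x) by rewrite addrC subrK.
rewrite {1}ex (linD rl) [X in _ + X]rN ?addr0; last exact: high_trunc.
rewrite /trunc (lin_sum rl); apply: eq_bigr => u _.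
by rewrite (linZ rl).
Qed.

Variable D : nat -> 'End(U).

Definition word_op u : 'End(U) := foldr (fun k f => D k.+1 \o f)%VF \1%VF u.

Lemma word_op_cat u v : word_op (u ++ v) = (word_op u \o word_op v)%VF.
Proof. by elim: u => [|k u IH] /=; rewrite ?comp_lfun1l // IH comp_lfunA. Qed.

Variable N : nat.
Hypothesis DN : forall u, (N <= wt u)%N -> word_op u = 0.

Definition rep x : 'End(U) := \sum_(u <- words_below N) x u *: word_op u.

Lemma rep_linear : linear rep.
Proof.
move=> a x y; rewrite /rep scaler_sumr -big_split /=; apply: eq_bigr => u _.
by rewrite addWE scaleWE scalerDl scalerA.
Qed.

Lemma rep_high x : high N x -> rep x = 0.
Proof.
move=> hx; rewrite /rep big_seq big1 // => u.
by rewrite mem_words_below => uN; rewrite hx ?scale0r.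
Qed.

Lemma rep_mon u : rep (mon K u) = word_op u.
Proof.
rewrite /rep; case: (ltnP (wt u) N) => uN; last first.
  rewrite DN // big_seq big1 // => v; rewrite mem_words_below => vN.
  rewrite /mon; case: eqP => [e|]; last by rewrite scale0r.
  by rewrite -e leqNgt vN in uN.
rewrite (bigD1_seq u) ?undup_uniq ?mem_words_below //= big1.
  by rewrite /mon eqxx scale1r addr0.
by move=> v nv; rewrite /mon (negPf nv) scale0r.
Qed.

Lemma rep1 : rep 1 = \1%VF.
Proof. exact: (rep_mon [::]). Qed.

Lemma repM x y : rep (x * y) = (rep x \o rep y)%VF.
Proof.
have -> : rep (x * y) = rep (trunc N x * trunc N y).
  have -> : x * y = trunc N x * trunc N y +
      (trunc N x * (y - trunc N y) + (x - trunc N x) * y).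
    by rewrite mulrBl mulrBr addrA (addrC (trunc N x * trunc N y)) subrK
       [RHS]addrC subrK.
  rewrite (linD rep_linear) (@rep_high (_ + _)) ?addr0 // => u uN.
  rewrite addWE (highMl _ (@high_trunc _ N x)) //.
  by rewrite (highMr _ (@high_trunc _ N y)) // addr0.
rewrite /trunc mulr_suml (lin_sum rep_linear).
rewrite [in RHS]/rep comp_suml; apply: eq_bigr => u _.
rewrite mulr_sumr (lin_sum rep_linear) comp_sumr; apply: eq_bigr => v _.
rewrite -scalerAl -scalerAr monM !(linZ rep_linear) rep_mon word_op_cat.
by rewrite -comp_lfunZl -comp_lfunZr !scalerA mulrC.
Qed.

End Reps.

Lemma rho_trunc (M : wmod) N x : (forall x, high N x -> rho M x = 0) -> 
  rho M x = \sum_(u <- words_below N) x u *: rho M (mon K u).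
Proof. by move=> h; apply: linear_trunc => //; exact: rho_linear. Qed.

Lemma rho_mon (M : wmod) u :
  rho M (mon K u) = word_op (fun n => rho M (w_ K n)) u.
Proof.
elim: u => [|k u IH] /=; first exact: rho1.
by rewrite -IH -rhoM /w_ /= monM.
Qed.

Definition intertwines (M1 M2 : wmod) (f : 'Hom(M1, M2)) :=
  forall x (m : M1), f (rho M1 x m) = rho M2 x (f m).

Lemma intertwines_letters (M1 M2 : wmod) (f : 'Hom(M1, M2)) :
  (forall n m, f (rho M1 (w_ K n) m) = rho M2 (w_ K n) (f m)) ->
  intertwines f.
Proof.
move=> h x m; have [N1 h1] := rho_continuous M1; have [N2 h2] := rho_continuous M2.
pose N := maxn N1 N2.
have high_le n x' : (n <= N)%N -> high N x' -> high n x'.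
  by move=> nN hx u un; apply: hx; apply: leq_trans un nN.
rewrite (@rho_trunc M1 N); last first.
  by move=> x' hx; apply: h1; apply: high_le hx; rewrite leq_maxl.
rewrite (@rho_trunc M2 N); last first.
  by move=> x' hx; apply: h2; apply: high_le hx; rewrite leq_maxr.
rewrite !sum_lfunE linear_sum; apply: eq_bigr => u _.
rewrite !scale_lfunE linearZ /=; congr (_ *: _).
rewrite !rho_mon; elim: u => [|k u IH] /=; first by rewrite !id_lfunE.
by rewrite !comp_lfunE h IH.
Qed.

Section TensorModule.
Variables M1 M2 : wmod.

(* The extension of rho_1 (x) rho_2 to the completed tensor square; by
   continuity the sum has finite support. *)
Definition act2 (F : W2 K) : 'End(tensv M1 M2) :=
  \sum_(p \in [set: word * word])
     F p *: tmap (rho M1 (mon K p.1)) (rho M2 (mon K p.2)).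

Definition trho x : 'End(tensv M1 M2) := act2 (coprod x).

Let E (p : word * word) : 'End(tensv M1 M2) :=
  tmap (rho M1 (mon K p.1)) (rho M2 (mon K p.2)).

Definition tbound N := forall p, (N <= wt p.1)%N || (N <= wt p.2)%N -> E p = 0.

Lemma tbound_ex : exists N, tbound N.
Proof.
have [N1 h1] := rho_continuous M1; have [N2 h2] := rho_continuous M2.
exists (maxn N1 N2) => p; rewrite /E.
have hm n u : (n <= wt u)%N -> high n (mon K u).
  move=> nu v vn; rewrite /mon; case: eqP => // e.
  by rewrite e ltnNge nu in vn.
case/orP=> h; first by rewrite h1 ?(bilin0l (tmap_bilin _ _ _ _)) //;
  apply: hm; apply: leq_trans h; rewrite leq_maxl.
by rewrite h2 ?(bilin0r (tmap_bilin _ _ _ _)) //;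
  apply: hm; apply: leq_trans h; rewrite leq_maxr.
Qed.

Section Bound.
Variable N : nat.
Hypothesis hN : tbound N.

Lemma act2E F : act2 F =
  \sum_(p <- [seq (u, v) | u <- words_below N, v <- words_below N]) F p *: E p.
Proof.
rewrite /act2.
rewrite (fsbigE [seq (u, v) | u <- words_below N, v <- words_below N]) //.
- by apply: eq_bigl => p; rewrite in_setT.
- by apply: allpairs_uniq; rewrite ?undup_uniq // => -[a b] [c d].
move=> [u v] _ /negP np; rewrite -/(E (u, v)) hN ?scaler0 //=.
case: (leqP N (wt u)) => //= uN; case: (leqP N (wt v)) => //= vN; case: np.
by apply/allpairsP; exists (u, v); rewrite !mem_words_below.
Qed.

Lemma act2_linear : linear act2.
Proof.
move=> a F G; rewrite !act2E scaler_sumr -big_split /=; apply: eq_bigr => p _.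
by rewrite addW2E scaleW2E scalerDl scalerA.
Qed.
Lemma act2_high F : high2 N F -> act2 F = 0.
Proof.
move=> hF; rewrite act2E big_seq big1 // => p /allpairsP[[u v] /= [uN vN ->]].
by rewrite hF ?scale0r //= -mem_words_below.
Qed.

Lemma act2_mon q : act2 (mon2 K q) = E q.
Proof.
rewrite act2E.
case: (boolP (q \in [seq (u, v) | u <- words_below N, v <- words_below N])).
  move=> qin; rewrite (bigD1_seq q) //=; last first.
    by apply: allpairs_uniq; rewrite ?undup_uniq // => -[a b] [c d].
  rewrite /mon2 eqxx scale1r big1 ?addr0 // => p /negPf ->.
  by rewrite scale0r.
move=> nq; rewrite big_seq big1.
  rewrite hN //; case: (leqP N (wt q.1)) => //= uN; case: (leqP N (wt q.2)) => // vN.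
  case/negP: nq; apply/allpairsP; exists q; rewrite !mem_words_below.
  by split=> //; case: q {uN vN}.
move=> p pin; rewrite /mon2; case: eqP => [e|]; last by rewrite scale0r.
by rewrite e (negPf nq) in pin.
Qed.

Lemma act2_monM q F : act2 (W2mul (mon2 K q) F) = (E q \o act2 F)%VF.
Proof.
pose s := [seq (u, v) | u <- words_below N, v <- words_below N].
pose T : W2 K := \sum_(r <- s) F r *: mon2 K r.
have hT : high2 N (F - T).
  move=> p p1 p2; rewrite addW2E oppW2E /T sumW2E.
  rewrite (bigD1_seq p) /=; last first.
  - by apply: allpairs_uniq; rewrite ?undup_uniq // => -[a b] [c d].
  - by apply/allpairsP; exists p; rewrite !mem_words_below; split=> //; case: (p).
  rewrite scaleW2E /mon2 eqxx mulr1 big1 ?addr0 ?subrr // => r nr.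
  by rewrite scaleW2E eq_sym (negPf nr) mulr0.
have eF : F = T + (F - T) by rewrite addrC subrK.
rewrite {1}eF W2mulDr linD; last exact: act2_linear.
rewrite [in RHS]eF [act2 (T + _)]linD; last exact: act2_linear.
rewrite (act2_high (high2M q hT)) (act2_high hT) !addr0.
rewrite {hT eF} /T; elim: s => [|r s IH].
  by rewrite !big_nil W2mul0r (lin0 act2_linear) comp_lfun0r.
rewrite !big_cons W2mulDr !(linD act2_linear) IH comp_lfunDr; congr (_ + _).
rewrite W2mulZr !(linZ act2_linear) -comp_lfunZr mon2M !act2_mon; congr (_ *: _).
by rewrite /E /= -!monM !rhoM tmap_comp.
Qed.

Definition tD n : 'End(tensv M1 M2) :=
  \sum_(i < n.+1) tmap (rho M1 (w_ K i)) (rho M2 (w_ K (n - i))).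

Lemma act2_letter n F : act2 (W2mul (coprod_letter K n) F) = (tD n \o act2 F)%VF.
Proof.
rewrite /coprod_letter /tD comp_suml.
have -> : W2mul (\sum_(i < n.+1) wtens (w_ K i) (w_ K (n - i))) F =
  \sum_(i < n.+1) W2mul (wtens (w_ K i) (w_ K (n - i))) F.
  by elim/big_rec2: _ => [|i y1 y2 _ <-]; rewrite ?W2mul0l ?W2mulDl.
rewrite (lin_sum act2_linear); apply: eq_bigr => i _.
by rewrite /w_ wtens_mon act2_monM.
Qed.

Lemma act2_word u : act2 (coprod_word K u) = word_op tD u.
Proof.
elim: u => [|k u IH] /=; last by rewrite act2_letter IH.
rewrite [X in wtens X _](_ : _ = mon K [::]) // wtens_mon act2_mon /E /=.
by rewrite !rho1 tmap1.
Qed.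

Lemma tD_bound u : (N.*2 <= wt u)%N -> word_op tD u = 0.
Proof.
move=> uN; rewrite -act2_word act2_high // => p p1 p2; rewrite coprod_word_wt //.
by move=> e; have := leq_add p1 (ltnW p2); rewrite addSn e addnn ltnNge uN.
Qed.

Lemma trhoE x : trho x = rep tD N.*2 x.
Proof.
rewrite /trho /rep act2E.
transitivity (\sum_(u <- words_below N.*2)
  \sum_(p <- [seq (u, v) | u <- words_below N, v <- words_below N])
    (x u * coprod_word K u p) *: E p); last first.
  apply: eq_bigr => u _; rewrite -act2_word act2E scaler_sumr.
  by apply: eq_bigr => p _; rewrite scalerA.
rewrite exchange_big /=; rewrite big_seq [RHS]big_seq.
apply: eq_bigr => p /allpairsP[[u v] /= [uN vN ->]].
rewrite !mem_words_below in uN vN.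
rewrite (@coprodE _ N.*2) /=; last first.
  by have := leq_add uN (ltnW vN); rewrite addSn addnn.
by rewrite scaler_suml.
Qed.

End Bound.

Lemma trho_linear : linear trho.
Proof.
by have [N hN] := tbound_ex; move=> a x y; rewrite !(trhoE hN) rep_linear.
Qed.
Lemma trho1 : trho 1 = \1%VF.
Proof. by have [N hN] := tbound_ex; rewrite (trhoE hN) rep1 //; apply: tD_bound. Qed.
Lemma trhoM x y : trho (x * y) = (trho x \o trho y)%VF.
Proof. by have [N hN] := tbound_ex; rewrite !(trhoE hN) repM //; apply: tD_bound. Qed.
Lemma trho_continuous : exists N, forall x, high N x -> trho x = 0.
Proof.
have [N hN] := tbound_ex; exists N.*2 => x hx.
by rewrite (trhoE hN) rep_high.
Qed.

Definition tmod : wmod := WMod trho_linear trho1 trhoM trho_continuous.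

Lemma tmod_w n : rho tmod (w_ K n) = tD n.
Proof.
have [N hN] := tbound_ex; rewrite /= (trhoE hN) rep_mon; last exact: tD_bound.
case: n => [|n] /=; last by rewrite comp_lfun1r.
by rewrite /tD big_ord_recl big_ord0 addr0 /w_ /= !rho1 tmap1.
Qed.

Lemma tmod_wE n m1 m2 : rho tmod (w_ K n) (tens m1 m2) =
  \sum_(i < n.+1) tens (rho M1 (w_ K i) m1) (rho M2 (w_ K (n - i)) m2).
Proof.
by rewrite tmod_w /tD sum_lfunE; apply: eq_bigr => i _; rewrite tmapE.
Qed.

End TensorModule.

End Modules.

Lemma hom_sum (K : fieldType) (A B : vectType K) (f : 'Hom(A, B)) I (r : seq I)
    (F : I -> A) : f (\sum_(i <- r) F i) = \sum_(i <- r) f (F i).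
Proof. exact: linear_sum. Qed.

Lemma sum_triangle (V : nmodType) (F : nat -> nat -> nat -> V) n :
  \sum_(i < n.+1) \sum_(j < i.+1) F j (i - j)%N (n - i)%N =
  \sum_(i < n.+1) \sum_(j < (n - i).+1) F i j (n - i - j)%N.
Proof.
transitivity (\sum_(i < n.+1) \sum_(j < n.+1 | (j < i.+1)%N) F j (i - j)%N (n - i)%N).
  apply: eq_bigr => i _.
  by rewrite (big_ord_widen n.+1 (fun j => F j (i - j)%N (n - i)%N)).
rewrite (exchange_big_dep xpredT) //=; apply: eq_bigr => j _.
rewrite -(big_geq_mkord j n.+1 xpredT (fun i => F j (i - j)%N (n - i)%N)).
rewrite -{1}[nat_of_ord j]add0n big_addn subSn -1?ltnS // big_mkord.
by apply: eq_bigr => k _; rewrite addnK addnC subnDA.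
Qed.

Section ModuleCategory.
Variable K : fieldType.
Implicit Types M : wmod K.

Lemma W1_nil : (1 : W K) [::] = 1.
Proof. by rewrite [LHS]/(Wone K _) /Wone eqxx. Qed.

Lemma WM_nil (x y : W K) : (x * y) [::] = x [::] * y [::].
Proof. exact: Wmul_nil. Qed.

(* The unit object: W acts on K through the counit. *)
Definition urho (x : W K) : 'End(K^o : vectType K) := x [::] *: \1%VF.

Lemma urho_linear : linear urho.
Proof. by move=> a x y; rewrite /urho addWE scaleWE scalerDl scalerA. Qed.
Lemma urho1 : urho 1 = \1%VF.
Proof. by rewrite /urho W1_nil scale1r. Qed.
Lemma urhoM x y : urho (x * y) = (urho x \o urho y)%VF.
Proof.
by rewrite /urho WM_nil -comp_lfunZl -comp_lfunZr scalerA comp_lfun1l.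
Qed.
Lemma urho_continuous : exists N, forall x, high N x -> urho x = 0.
Proof. by exists 1%N => x hx; rewrite /urho hx ?scale0r. Qed.

Definition umod : wmod K := WMod urho_linear urho1 urhoM urho_continuous.

Lemma urho_w n a : rho umod (w_ K n) a = (n == 0%N)%:R *: a.
Proof. by rewrite /= /urho /w_ /mon scale_lfunE id_lfunE; case: n. Qed.

Section Hom.
Variables M1 M2 : wmod K.

Definition intertwiner : {pred 'Hom(M1, M2)} :=
  fun f => `[< forall x m, f (rho M1 x m) = rho M2 x (f m) >].

Fact intertwiner_submod : subsemimod_closed intertwiner.
Proof.
split=> [|a f /asboolP hf]; last first.
  by apply/asboolP => x m; rewrite !scale_lfunE hf linearZ.
split=> [|f g /asboolP hf /asboolP hg]; apply/asboolP => x m.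
  by rewrite !zero_lfunE linear0.
by rewrite !add_lfunE hf hg linearD.
Qed.
HB.instance Definition _ := GRing.isSubmodClosed.Build K 'Hom(M1, M2) intertwiner
  intertwiner_submod.

Record whom := WHom { whom_lfun : 'Hom(M1, M2); _ : intertwiner whom_lfun }.
HB.instance Definition _ := [isSub for whom_lfun].
HB.instance Definition _ := [Choice of whom by <:].
HB.instance Definition _ := [SubChoice_isSubZmodule of whom by <:].
HB.instance Definition _ := [SubZmodule_isSubLmodule of whom by <:].

Lemma whomP (f : whom) x m : whom_lfun f (rho M1 x m) = rho M2 x (whom_lfun f m).
Proof. by case: f => f i /=; move/asboolP: (i); apply. Qed.

Definition mk_whom (f : 'Hom(M1, M2)) (h : intertwines f) : whom :=
  @WHom f (asboolT h).

Lemma whomE (f g : whom) : whom_lfun f = whom_lfun g -> f = g.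
Proof. exact: val_inj. Qed.

End Hom.

Lemma id_intertwines M : intertwines (\1%VF : 'End(M)).
Proof. by move=> x m; rewrite !id_lfunE. Qed.

Lemma comp_intertwines M1 M2 M3 (g : whom M2 M3) (f : whom M1 M2) :
  intertwines (whom_lfun g \o whom_lfun f)%VF.
Proof. by move=> x m; rewrite !comp_lfunE !whomP. Qed.

Definition whom_id M : whom M M := mk_whom (@id_intertwines M).
Definition whom_comp M1 M2 M3 (g : whom M2 M3) (f : whom M1 M2) : whom M1 M3 :=
  mk_whom (comp_intertwines g f).

Definition C_W_cat : lincat K.
Proof.
refine (@Lincat K (wmod K) (fun M1 M2 => whom M1 M2 : lmodType K)
  whom_id whom_comp _ _ _ _ _).
- abstract (by move=> *; apply: whomE; exact: comp_lfunA).
- abstract (by move=> *; apply: whomE; exact: comp_lfun1l).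
- abstract (by move=> *; apply: whomE; exact: comp_lfun1r).
- abstract (by move=> *; apply: whomE; exact: vect_comp_linl).
- abstract (by move=> *; apply: whomE; exact: vect_comp_linr).
Defined.

Lemma intertwines_tens M1 M2 M3 (f : 'Hom(tmod M1 M2, M3)) :
  (forall n m1 m2, f (rho (tmod M1 M2) (w_ K n) (tens m1 m2))
     = rho M3 (w_ K n) (f (tens m1 m2))) -> intertwines f.
Proof.
move=> h; apply: intertwines_letters => n m.
rewrite -!comp_lfunE; congr (fun_of_lfun _ _).
by apply: (@tens_ext K M1 M2 M3) => m1 m2; rewrite !comp_lfunE.
Qed.

Lemma tmor_intertwines M1 M1' M2 M2' (f : whom M1 M1') (g : whom M2 M2') :
  @intertwines K (tmod M1 M2) (tmod M1' M2') (tmap (whom_lfun f) (whom_lfun g)).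
Proof.
apply: intertwines_tens => n m1 m2.
rewrite tmapE !tmod_wE linear_sum; apply: eq_bigr => i _.
by rewrite /= tmapE !whomP.
Qed.

Lemma assoc_intertwines M1 M2 M3 :
  @intertwines K (tmod (tmod M1 M2) M3) (tmod M1 (tmod M2 M3)) (tassoc M1 M2 M3).
Proof.
apply: intertwines_letters => n m.
rewrite -!comp_lfunE; congr (fun_of_lfun _ _).
apply: tens3_ext => x y z; rewrite !comp_lfunE tassocE tmod_wE.
rewrite (tmod_wE (M1 := tmod M1 M2) (M2 := M3) n (tens x y) z) (hom_sum (tassoc M1 M2 M3)).
transitivity (\sum_(i < n.+1) \sum_(j < i.+1) tens (rho M1 (w_ K j) x)
  (tens (rho M2 (w_ K (i - j)) y) (rho M3 (w_ K (n - i)) z))).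
  apply: eq_bigr => i _; rewrite tmod_wE (bilin_suml (tens_bilin _ _)) (hom_sum (tassoc M1 M2 M3)).
  by apply: eq_bigr => j _; exact: tassocE.
rewrite (sum_triangle (fun a b c => tens (rho M1 (w_ K a) x)
  (tens (rho M2 (w_ K b) y) (rho M3 (w_ K c) z)))).
by apply: eq_bigr => i _; rewrite tmod_wE (bilin_sumr (tens_bilin _ _)).
Qed.

Lemma lunit_intertwines M : @intertwines K (tmod umod M) M (tlunit M).
Proof.
apply: intertwines_tens => n a m; rewrite tmod_wE linear_sum big_ord_recl big1.
  by rewrite addr0 /= subn0 urho_w tlunitE scale1r tlunitE linearZ.
move=> i _; rewrite urho_w scale0r (bilin0l (tens_bilin _ _)).
exact: (linear0 (tlunit M)).
Qed.

Lemma runit_intertwines M : @intertwines K (tmod M umod) M (trunit M).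
Proof.
apply: intertwines_tens => n m a; rewrite tmod_wE linear_sum big_ord_recr big1.
  by rewrite /= add0r subnn urho_w trunitE scale1r trunitE linearZ.
move=> i _; rewrite urho_w /= subn_eq0 leqNgt ltn_ord scale0r.
rewrite (bilin0r (tens_bilin _ _)); exact: (linear0 (trunit M)).
Qed.

Lemma inv_intertwines M1 M2 (f : 'Hom(M1, M2)) (g : 'Hom(M2, M1)) :
  intertwines f -> (g \o f)%VF = \1%VF /\ (f \o g)%VF = \1%VF -> intertwines g.
Proof.
move=> hf [gf fg] x m; have /= := congr1 (fun h : 'End(M2) => g (rho M2 x (h m))) fg.
rewrite comp_lfunE id_lfunE -hf -[g (f _)]comp_lfunE gf id_lfunE.
by move<-.
Qed.

Lemma braid_intertwines M1 M2 : @intertwines K (tmod M1 M2) (tmod M2 M1) (tbraid M1 M2).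
Proof.
apply: intertwines_tens => n x y; rewrite tbraidE !tmod_wE linear_sum.
rewrite [RHS](reindex_inj rev_ord_inj) /=; apply: eq_bigr => i _.
by rewrite tbraidE subSS subKn // -ltnS.
Qed.

Definition C_W : tensor_category K.
Proof.
refine (@TensorCategory K C_W_cat (@tmod K)
  (fun M1 M1' M2 M2' f g => mk_whom (tmor_intertwines f g)) umod
  (fun M1 M2 M3 => mk_whom (@assoc_intertwines M1 M2 M3))
  (fun M1 M2 M3 => mk_whom (inv_intertwines (@assoc_intertwines M1 M2 M3) (tassocK M1 M2 M3)))
  (fun M => mk_whom (@lunit_intertwines M))
  (fun M => mk_whom (inv_intertwines (@lunit_intertwines M) (tlunitK M)))
  (fun M => mk_whom (@runit_intertwines M))
  (fun M => mk_whom (inv_intertwines (@runit_intertwines M) (trunitK M)))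
  (fun M1 M2 => mk_whom (@braid_intertwines M1 M2))
  _ _ _ _ _ _ _ _ _ _ _ _ _ _ _).
- abstract (by move=> *; apply: whomE; exact: tmap1).
- abstract (by move=> *; apply: whomE; exact: tmap_comp).
- abstract (by move=> A A' B B' g a f f'; apply: whomE; exact: (tmap_bilin A A' B B').1).
- abstract (by move=> A A' B B' f a g g'; apply: whomE; exact: (tmap_bilin A A' B B').2).
- abstract (by move=> *; apply: whomE; exact: tassoc_nat).
- abstract (by move=> A B C; have [h1 h2] := tassocK A B C; split; apply: whomE).
- abstract (by move=> *; apply: whomE; exact: tlunit_nat).
- abstract (by move=> A; have [h1 h2] := tlunitK A; split; apply: whomE).
- abstract (by move=> *; apply: whomE; exact: trunit_nat).
- abstract (by move=> A; have [h1 h2] := trunitK A; split; apply: whomE).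
- abstract (by move=> *; apply: whomE; exact: tbraid_nat).
- abstract (by move=> *; apply: whomE; exact: tbraidK).
- abstract (by move=> *; apply: whomE; exact: tpentagon).
- abstract (by move=> *; apply: whomE; exact: ttriangle).
- abstract (by move=> *; apply: whomE; exact: thexagon).
Defined.

End ModuleCategory.

Section Transport.
Variable K : numFieldType.

(* x_W(t) = 1 + \sum_(m >= 1) w_m t^m. *)
Definition x_W (t : K) : W K := fun u =>
  match u with [::] => 1 | [:: k] => t ^+ k.+1 | _ => 0 end.

Definition H1 (M : nat) : K := \sum_(1 <= n < M.+1) n%:R^-1.

Fixpoint P_ (M : nat) : W K :=
  if M is M'.+1 then x_W (M'.+1%:R^-1) * P_ M' else 1.

(* exp, with the series and the limit taken coefficientwise; likewise C_star is
   the limit in each quotient of W by the terms of weight > n, since such a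
   quotient involves finitely many coefficients. *)
Definition expW (x : W K) : W K := fun u =>
  lim ((fun n => \sum_(k < n) k`!%:R^-1 * (x ^+ k) u) @ \oo).

Definition C_approx (M : nat) : W K := expW (- H1 M *: w_ K 1) * P_ M.
Definition C_star : W K := fun u => lim ((fun M => C_approx M u) @ \oo).

Section Limits.
Variable V : vectType K.

(* The topology of a finite-dimensional space, through coordinates. *)
Definition vcvg (s : nat -> V) (l : V) := forall i,
  (fun n => coord (vbasis {:V}) i (s n)) @ \oo --> coord (vbasis {:V}) i l.

Definition vlim (s : nat -> V) : V :=
  \sum_i lim ((fun n => coord (vbasis {:V}) i (s n)) @ \oo) *: (vbasis {:V})`_i.

Definition expE (A : 'End(V)) (v : V) : V :=
  vlim (fun n => \sum_(k < n) k`!%:R^-1 *: iter k A v).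
End Limits.

Section DifferenceSystem.
Variable M : wmod K.

(* Index shift: Y k is the value Y(k+1), so a function on nat is a sequence
   Y(1), Y(2), ... *)
Definition is_sol : {pred nat -> M} := fun Y =>
  `[< forall k, Y k.+1 = rho M (x_W k.+1%:R^-1) (Y k) >].

Fact is_sol_submod : subsemimod_closed is_sol.
Proof.
split=> [|a Y /asboolP hY]; last first.
  by apply/asboolP => k; rewrite !scalrfctE hY linearZ.
split=> [|Y Z /asboolP hY /asboolP hZ]; apply/asboolP => k.
  by rewrite [LHS]/(0 : M) linear0.
by rewrite !addrfctE hY hZ linearD.
Qed.
HB.instance Definition _ := GRing.isSubmodClosed.Build K (nat -> M) is_sol
  is_sol_submod.

Record Sol := MkSol { sol_seq :> nat -> M; _ : is_sol sol_seq }.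
HB.instance Definition _ := [isSub for sol_seq].
HB.instance Definition _ := [Choice of Sol by <:].
HB.instance Definition _ := [SubChoice_isSubZmodule of Sol by <:].
HB.instance Definition _ := [SubZmodule_isSubLmodule of Sol by <:].
End DifferenceSystem.

(* All fibers of the constant bundle with fiber M are copies of M, identified
   with M by the constant trivialization triv. *)
Inductive base_point := at_1 | at_oo.

Definition fiber (p : base_point) (M : wmod K) : vectType K := M.
Definition triv (p : base_point) (M : wmod K) : 'Hom(fiber p M, M) := \1%VF.

Definition omega (p : base_point) : tensor_functor_data (C_W K) (Vect K) :=
  @TensorFunctorData K (C_W K) (Vect K) (fiber p)
    (fun M1 M2 (f : whom M1 M2) => whom_lfun f)
    (fun M1 M2 => \1%VF) \1%VF.

Definition ev_1 (M : wmod K) (Y : Sol M) : fiber at_1 M := Y 0%N.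

(* Y m is the value at m + 1 of the solution. *)
Definition lc_seq (M : wmod K) (Y : Sol M) (m : nat) : fiber at_oo M :=
  expE (- H1 m *: rho M (w_ K 1)) (Y m).
Definition lc_oo (M : wmod K) (Y : Sol M) : fiber at_oo M := vlim (lc_seq Y).

Definition T_alg (M : wmod K) : 'Hom(fiber at_1 M, fiber at_oo M) := \1%VF.
Definition T_hor (M : wmod K) : 'Hom(fiber at_1 M, fiber at_oo M) := rho M C_star.

(* The family of endomorphisms through which c in W acts on the fibers. *)
Definition represented_by (c : W K) (M : wmod K) : 'End(fiber at_1 M) := rho M c.

Definition is_fiber_functor (C : tensor_category K) (F : tensor_functor_data C (Vect K)) :=
  [/\ is_tensor_functor F, is_exact F & is_faithful F].

End Transport.

Definition omega_1 (K : numFieldType) := omega K at_1.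
Definition omega_oo (K : numFieldType) := omega K at_oo.

(* Main.v *)
Require Import Defs.
From HB Require Import structures.
From mathcomp Require Import all_boot all_order all_algebra.
From mathcomp Require Import boolp classical_sets functions cardinality fsbigop.
From mathcomp Require Import reals topology normedtype sequences.
From mathcomp.real_closed Require Import complex.
From mathcomp Require Import zify ring lra.
Import Order.TTheory GRing.Theory Num.Theory numFieldNormedType.Exports.
Local Open Scope classical_set_scope.
Local Open Scope ring_scope.
Set Implicit Arguments.
Unset Strict Implicit.
Unset Printing Implicit Defensive.

(** The fiber functors forget the action, so linearity, compatibility with
    tensor products and faithfulness are immediate. Exactness asks that kernels
    and cokernels taken among modules be kernels and cokernels of vector spaces.
    A submodule of a module is again a module, so the linear kernel of a
    morphism can be tested against the universal property (kernel_inj,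
    kernel_limg), and so can its image (cokernel_surj).

    For the limit, put E_M = exp(- H_1(M) w_1), so that the regularized product
    is C_M = E_M P_M. Since exp is a morphism on multiples of w_1,
      C_{M+1} - C_M = E_M (exp(- t w_1) x_W(t) - 1) P_M   with t = 1/(M+1).
    The terms of order t cancel in the middle factor, whose coefficients are
    O(t^2), while those of E_M and P_M at a word u are at most H_1(M)^|u|.
    Each coefficient of C_M is thus controlled by a series
    sum_M H_1(M)^k / M^2, and these converge (weighted_sum_bounded, by
    induction on k through summation by parts). All these coefficients are
    real, so that completeness of the real line is enough.

    An element g of W acts on a tensor product by rho_1(g) (x) rho_2(g) as soon
    as its homogeneous components satisfy the divided power formula
    Delta g_n = sum_i g_i (x) g_{n-i} (grouplike_divided_powers). This holds for
    x_W(t), by definition of Delta_*, and for exp(c w_1), whose components are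
    the divided powers of a primitive element. Products and limits inherit the
    property, hence C_* has it, and its constant term is 1. On a continuous
    module C_* is therefore a unipotent, hence invertible, operator compatible
    with tensor products (grouplike_tensor_iso). Naturality is W-linearity.

    Finally the solution with initial value v is Y(M+1) = rho(P_M) v, so the
    regularized sequence is rho(C_M) v; on a continuous module only finitely
    many coefficients of C_M act, and it converges to rho(C_star) v. *)

(** * Exactness of the forgetful functors *)

Section FiberFunctors.
Variable K : fieldType.
Implicit Types M : wmod K.

Section Submodule.
Variables (M : wmod K) (S : {vspace M}).
Hypothesis S_stable : forall x m, m \in S -> rho M x m \in S.

Let vsvalH : 'Hom(subvs_of S, M) := linfun vsval.
Let vsprojH : 'Hom(M, subvs_of S) := linfun (vsproj S).

Definition sub_rho (x : W K) : 'End(subvs_of S : vectType K) :=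
  (vsprojH \o (rho M x \o vsvalH))%VF.

Lemma vsval_sub_rho x s : vsval (sub_rho x s) = rho M x (vsval s).
Proof. by rewrite !comp_lfunE !lfunE /= vsprojK // S_stable // subvsP. Qed.

Fact sub_rho_linear : linear sub_rho.
Proof.
move=> a x y; rewrite /sub_rho rho_linear.
by rewrite comp_lfunDl comp_lfunDr -comp_lfunZl -comp_lfunZr.
Qed.

Fact sub_rho1 : sub_rho 1 = \1%VF.
Proof.
by apply/lfunP => s; apply: val_inj; rewrite /= vsval_sub_rho rho1 !id_lfunE.
Qed.

Fact sub_rhoM x y : sub_rho (x * y) = (sub_rho x \o sub_rho y)%VF.
Proof.
apply/lfunP => s; apply: val_inj.
by rewrite /= [in RHS]comp_lfunE !vsval_sub_rho rhoM comp_lfunE.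
Qed.

Fact sub_rho_continuous : exists N, forall x, high N x -> sub_rho x = 0.
Proof.
have [N hN] := rho_continuous M; exists N => x /hN h.
by rewrite /sub_rho h comp_lfun0l comp_lfun0r.
Qed.

Definition submod : wmod K :=
  WMod sub_rho_linear sub_rho1 sub_rhoM sub_rho_continuous.

Fact submod_incl_intertwines : @intertwines K submod M vsvalH.
Proof.
have vE t : vsvalH t = vsval t by rewrite lfunE.
by move=> x s; rewrite !vE; exact: vsval_sub_rho.
Qed.

Definition submod_incl : whom submod M := mk_whom submod_incl_intertwines.

Lemma submod_inclE (s : submod) : whom_lfun submod_incl s = vsval s.
Proof. exact: lfunE. Qed.

Lemma submod_factor (L : wmod K) (f : whom L M) :
  (forall l, whom_lfun f l \in S) ->
  exists f' : whom L submod, whom_comp submod_incl f' = f.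
Proof.
move=> fS; pose f0 : 'Hom(L, submod) := (vsprojH \o whom_lfun f)%VF.
have f0E l : vsval (f0 l) = whom_lfun f l.
  by rewrite comp_lfunE lfunE vsprojK.
have f0i : intertwines f0.
  by move=> x l; apply: val_inj; rewrite [RHS]vsval_sub_rho [LHS]f0E f0E whomP.
exists (mk_whom f0i); apply: whomE; apply/lfunP => l /=.
by rewrite comp_lfunE submod_inclE /= f0E.
Qed.
End Submodule.

Lemma lker_stable M1 M2 (f : whom M1 M2) x m :
  m \in lker (whom_lfun f) -> rho M1 x m \in lker (whom_lfun f).
Proof. by rewrite !memv_ker whomP => /eqP->; rewrite linear0. Qed.

Lemma limg_stable M1 M2 (f : whom M1 M2) x m :
  m \in limg (whom_lfun f) -> rho M2 x m \in limg (whom_lfun f).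
Proof. by case/memv_imgP => l _ ->; rewrite -whomP memv_img ?memvf. Qed.

Lemma whom0 M1 M2 : whom_lfun (0 : whom M1 M2) = 0.
Proof. by []. Qed.

Lemma whom_comp0 M1 M2 M3 (g : whom M2 M3) : whom_comp g (0 : whom M1 M2) = 0.
Proof. by apply: whomE; rewrite /= comp_lfun0r. Qed.

Section Kernel.
Variables (A B E : wmod K) (f : whom A B) (g : whom B E).
Hypothesis fg : is_kernel (C := C_W_cat K) f g.

(** The inclusion of the linear kernel of [f] and the zero map have the same
    composite with [f], hence agree. *)
Lemma kernel_inj : injective (whom_lfun f).
Proof.
apply/lker0P; rewrite -subv0; apply/subvP => a ha; rewrite memv0.
pose j := submod_incl (lker_stable (f := f)).
have fj0 : whom_comp f j = 0.
  apply: whomE; apply/lfunP => s; rewrite whom0 /= comp_lfunE zero_lfunE.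
  by apply/eqP; rewrite -memv_ker (submod_inclE (S_stable := lker_stable (f := f))) subvsP.
have gfj0 : whom_comp g (whom_comp f j) = 0 by rewrite fj0 whom_comp0.
have [h' [_ huniq]] := fg.2 _ _ gfj0.
have j0 : j = 0 :> whom _ A.
  rewrite -(huniq j) //; apply: (huniq 0).
  by rewrite fj0; exact: whom_comp0.
pose s : submod (lker_stable (f := f)) := Subvs ha.
have := congr1 (fun k : whom _ A => whom_lfun k s) j0.
by rewrite submod_inclE /= => ->; rewrite zero_lfunE.
Qed.

(** The inclusion of the linear kernel of [g] factors through [f]. *)
Lemma kernel_limg : limg (whom_lfun f) = lker (whom_lfun g).
Proof.
apply/eqP; rewrite eqEsubv; apply/andP; split; apply/subvP => b.
  case/memv_imgP => a _ ->; rewrite memv_ker.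
  have := congr1 (fun k : whom A E => whom_lfun k a) fg.1.
  by rewrite /= comp_lfunE zero_lfunE => ->.
move=> hb; pose j := submod_incl (lker_stable (f := g)).
have gj0 : whom_comp g j = 0.
  apply: whomE; apply/lfunP => s; rewrite whom0 /= comp_lfunE zero_lfunE.
  by apply/eqP; rewrite -memv_ker (submod_inclE (S_stable := lker_stable (f := g))) subvsP.
have [h' [fh' _]] := fg.2 _ _ gj0.
pose s : submod (lker_stable (f := g)) := Subvs hb.
have := congr1 (fun k : whom _ B => whom_lfun k s) fh'.
by rewrite submod_inclE /= comp_lfunE => <-; rewrite memv_img ?memvf.
Qed.
End Kernel.

(** Quotient modules can be avoided: [g] factors through its image [I], the
    universal property of [g] provides a map [E -> I], and by uniqueness the
    composite [E -> I -> E] is the identity. *)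
Lemma cokernel_surj (A B E : wmod K) (f : whom A B) (g : whom B E) :
  is_cokernel (C := C_W_cat K) f g -> limg (whom_lfun g) = fullv.
Proof.
case=> gf0 univ; apply/eqP; rewrite eqEsubv subvf; apply/subvP => e _.
have gI b : whom_lfun g b \in limg (whom_lfun g) by rewrite memv_img ?memvf.
pose i := submod_incl (limg_stable (f := g)).
have [g' ig'] := submod_factor (limg_stable (f := g)) gI.
have g'f0 : whom_comp g' f = 0.
  apply: whomE; apply/lfunP => a; apply: val_inj.
  rewrite -[LHS]submod_inclE /= comp_lfunE.
  have := congr1 (fun k : whom B E => whom_lfun k (whom_lfun f a)) ig'.
  rewrite /= comp_lfunE => ->.
  have := congr1 (fun k : whom A E => whom_lfun k a) gf0.
  by rewrite /= comp_lfunE => ->; rewrite !zero_lfunE.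
have [h [hg _]] := univ _ _ g'f0.
have [k [_ kuniq]] := univ _ g gf0.
have ih : whom_comp i h = whom_id E.
  rewrite -(kuniq (whom_comp i h)); last first.
    by rewrite -[RHS]ig' -hg; apply: whomE; rewrite /= comp_lfunA.
  by apply: kuniq; apply: whomE; rewrite /= comp_lfun1l.
have := congr1 (fun k : whom E E => whom_lfun k e) ih.
rewrite /= comp_lfunE id_lfunE => <-.
by rewrite (submod_inclE (S_stable := limg_stable (f := g))) subvsP.
Qed.

Lemma vect_short_exact (A B E : vectType K) (f : 'Hom(A, B)) (g : 'Hom(B, E)) :
  injective f -> limg f = lker g -> limg g = fullv ->
  short_exact (C := Vect K) f g.
Proof.
move=> f_inj im_f g_surj.
have gf0 : (g \o f)%VF = 0.
  apply/lfunP => a; rewrite comp_lfunE zero_lfunE; apply/eqP.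
  by rewrite -memv_ker -im_f memv_img ?memvf.
split; split=> // X h h0.
- exists (f^-1 \o h)%VF; split.
    apply/lfunP => x; rewrite !comp_lfunE limg_lfunVK // im_f memv_ker.
    by rewrite -comp_lfunE [(_ \o _)%VF]h0 zero_lfunE.
  move=> h' <-; apply/lfunP => x; rewrite !comp_lfunE.
  by rewrite lker0_lfunK //; apply/lker0P.
- have gV e : g (g^-1%VF e) = e by rewrite limg_lfunVK // g_surj memvf.
  have hf0 a : (h : 'Hom(B, X)) (f a) = 0.
    by rewrite -comp_lfunE [(_ \o _)%VF]h0 zero_lfunE.
  exists (h \o g^-1)%VF; split.
    apply/lfunP => b; rewrite !comp_lfunE; apply/eqP; rewrite -subr_eq0 -linearB.
    have : g^-1%VF (g b) - b \in lker g by rewrite memv_ker linearB /= gV subrr.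
    rewrite -im_f => /memv_imgP [a _ ->].
    exact/eqP/hf0.
  by move=> h' <-; apply/lfunP => e; rewrite !comp_lfunE gV.
Qed.

End FiberFunctors.

Lemma omega_fiber_functor (K : numFieldType) p : is_fiber_functor (omega K p).
Proof.
have id_iso (V : vectType K) : is_iso (D := Vect K) (\1%VF : 'End(V)).
  by exists \1%VF; split; exact: comp_lfun1l.
split.
- split.
  + by split; [split | split => *; exact: id_iso].
  + by move=> *; rewrite /= comp_lfun1l comp_lfun1r.
  + by move=> A B E; rewrite /= !tmap1 !comp_lfun1l comp_lfun1r.
  + by move=> A; rewrite /= !tmap1 !comp_lfun1l !comp_lfun1r.
  + by move=> A B; rewrite /= comp_lfun1l comp_lfun1r.
- move=> A B E f g [kf cg]; apply: vect_short_exact.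
  + exact: kernel_inj kf.
  + exact: kernel_limg kf.
  + exact: cokernel_surj cg.
- by move=> A B f g /whomE.
Qed.

(** * The regularized product and its increments *)

Lemma WmulE (K : fieldType) (x y : W K) u :
  (x * y) u = \sum_(i < (size u).+1) x (take i u) * y (drop i u).
Proof. by []. Qed.

Section ExponentialLetter.
Variable K : numFieldType.

(** The coefficients of [exp (c w_1)]: the words that occur are the powers of
    [w_1], the letter coded by [0]. *)
Definition exp_w1 (c : K) : W K := fun u =>
  if all (pred1 0%N) u then c ^+ size u / (size u)`!%:R else 0.

Lemma w1_exprE c n (u : word) :
  ((c *: w_ K 1) ^+ n) u = c ^+ n * (u == nseq n 0%N)%:R.
Proof.
suff -> : (c *: w_ K 1) ^+ n = c ^+ n *: mon K (nseq n 0%N) by rewrite scaleWE.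
elim: n => [|n IH]; first by rewrite !expr0 scale1r.
by rewrite !exprS IH -scalerAl -scalerAr scalerA /w_ monM.
Qed.

Lemma all_pred1_size (u : word) n :
  (u == nseq n 0%N) = (size u == n) && all (pred1 0%N) u.
Proof.
apply/eqP/andP => [->|[/eqP <-]]; last exact/all_pred1P.
by rewrite size_nseq eqxx all_pred1_nseq.
Qed.

Lemma expW_w1 c : expW (c *: w_ K 1) = exp_w1 c.
Proof.
apply/funext => u; rewrite /expW; apply: cvg_lim => //.
apply: cvg_near_cst; near=> n.
have su : (size u < n)%N by near: n; exact: nbhs_infty_gt.
rewrite (bigD1 (Ordinal su)) //= big1 ?addr0.
  by rewrite w1_exprE all_pred1_size eqxx /exp_w1 mulrC; case: all;
     rewrite ?mulr1 ?mulr0 ?mul0r.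
move=> i /eqP ni; rewrite w1_exprE all_pred1_size; case: eqP => [e|_].
  by case: ni; apply: val_inj.
by rewrite !mulr0.
Unshelve. all: by end_near.
Qed.

Lemma exp_w1D a b : exp_w1 (a + b) = exp_w1 a * exp_w1 b.
Proof.
apply/funext => u; rewrite WmulE /exp_w1.
case: (boolP (all (pred1 0%N) u)) => [u0|nu0]; last first.
  rewrite big1 // => i _; rewrite -(cat_take_drop i u) all_cat negb_and in nu0.
  by case/orP: nu0 => /negPf ->; rewrite ?mul0r ?mulr0.
rewrite exprDn mulr_suml [RHS](reindex_inj rev_ord_inj).
apply: eq_bigr => i _; rewrite /= subSS.
have ile : (i <= size u)%N by rewrite -ltnS.
move: u0; rewrite -{1}(cat_take_drop (size u - i) u) all_cat => /andP[-> ->].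
rewrite size_drop size_takel ?leq_subr // subKn //.
have f0 m : m`!%:R != 0 :> K by rewrite pnatr_eq0 -lt0n fact_gt0.
rewrite -(bin_fact ile) -mulr_natr.
rewrite !natrM.
have B0 : 'C(size u, i)%:R != 0 :> K by rewrite pnatr_eq0 -lt0n bin_gt0.
by field; rewrite B0 !f0.
Qed.

Lemma C_approxE m : C_approx K m = exp_w1 (- H1 K m) * P_ K m.
Proof. by rewrite /C_approx expW_w1. Qed.

Lemma H1S m : H1 K m.+1 = H1 K m + m.+1%:R^-1.
Proof. by rewrite /H1 big_nat_recr. Qed.

Lemma H1_0 : H1 K 0 = 0.
Proof. by rewrite /H1 big_geq. Qed.

Lemma H1_ge0 m : 0 <= H1 K m.
Proof. by apply: sumr_ge0 => i _; rewrite invr_ge0. Qed.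

Lemma H1_ge1 m : 1 <= H1 K m.+1.
Proof.
rewrite /H1 big_nat_recl // invr1 lerDl.
by apply: sumr_ge0 => i _; rewrite invr_ge0.
Qed.

End ExponentialLetter.

Section Growth.
Variable K : numFieldType.

(** Bounds of this shape survive products, with constants that add up: this
    matches [P_M], a product of [M] factors of growth [1/n] whose constants add
    up to [H_1(M)]. *)
Definition growth (a : K) (x : W K) := forall u : word, `|x u| <= a ^+ size u.

Lemma growthM a b x y : growth a x -> growth b y -> growth (a + b) (x * y).
Proof.
move=> hx hy u; rewrite WmulE.
apply: (le_trans (ler_norm_sum _ _ _)).
have a0 : 0 <= a by apply: le_trans (hx [:: 0%N]).
have b0 : 0 <= b by apply: le_trans (hy [:: 0%N]).
rewrite addrC exprDn; apply: ler_sum => i _.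
rewrite normrM (le_trans (ler_pM _ _ (hx _) (hy _))) //.
rewrite size_drop size_takel -1?ltnS // mulrC.
by rewrite -[leLHS]mulr1n ler_wpMn2l // ?mulr_ge0 ?exprn_ge0 // bin_gt0 -ltnS.
Qed.

Lemma growth_le a b x : 0 <= a -> a <= b -> growth a x -> growth b x.
Proof.
by move=> a0 ab hx u; apply: le_trans (hx u) _; rewrite lerXn2r ?nnegrE ?(le_trans a0).
Qed.

Lemma growth1 : growth 0 1.
Proof. by case=> [|a u]; rewrite ?W1_nil ?normr1 ?expr0 // normr0 exprn_ge0. Qed.

Lemma growth_x_W (t : K) : 0 <= t <= 1 -> growth t (x_W t).
Proof.
case/andP=> t0 t1 [|k [|l u]] /=; rewrite ?normr1 ?normr0 ?exprn_ge0 //.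
by rewrite ger0_norm ?exprn_ge0 // exprS expr1 ler_piMr // exprn_ile1.
Qed.

Lemma growth_exp_w1 (c : K) : growth `|c| (exp_w1 c).
Proof.
move=> u; rewrite /exp_w1; case: all; last by rewrite normr0 exprn_ge0.
rewrite normrM normrX normfV normr_nat ler_piMr ?exprn_ge0 //.
by rewrite invf_le1 ?ltr0n ?ler1n fact_gt0.
Qed.

Lemma invS_itv m : 0 <= (m.+1%:R^-1 : K) <= 1.
Proof. by rewrite invr_ge0 ler0n invf_le1 ?ltr0n ?ler1n. Qed.

Lemma growth_P m : growth (H1 K m) (P_ K m).
Proof.
elim: m => [|m IH]; first by rewrite H1_0; exact: growth1.
by rewrite H1S addrC; apply: growthM IH; apply: growth_x_W; exact: invS_itv.
Qed.

(** The terms of order [t] cancel: this is why the factor [e^{-H_1(M) w_1}]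
    regularizes the product. *)
Lemma local_factor_bound (t : K) (u : word) : 0 <= t <= 1 ->
  `|(exp_w1 (- t) * x_W t - 1) u| <= t ^+ 2 * 2 ^+ size u.
Proof.
move=> /[dup] t01 /andP[t0 t1].
have g : growth (t + t) (exp_w1 (- t) * x_W t).
  apply: growthM (growth_x_W t01); have := @growth_exp_w1 (- t).
  by rewrite normrN ger0_norm.
rewrite addWE oppWE; case: u => [|k [|l u]].
- by rewrite WM_nil W1_nil /exp_w1 /= expr0 divr1 mulr1 subrr normr0 mulr_ge0 ?exprn_ge0.
- rewrite WmulE !big_ord_recl big_ord0 addr0 /= /exp_w1 /= expr0 divr1 mul1r mulr1.
  rewrite [(1 : W K) _]/(Wone K _) /Wone subr0 expr1.
  case: k => [|k] /=; last first.
    rewrite addr0 ger0_norm ?exprn_ge0 // 2!exprS mulrA -expr2 ler_wpM2l ?exprn_ge0 //.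
    by rewrite (le_trans (exprn_ile1 _ t0 t1)) // ler1n.
  by rewrite !expr1 divr1 subrr normr0 mulr_ge0 ?exprn_ge0.
- rewrite [(1 : W K) _]/(Wone K _) /Wone subr0.
  apply: (le_trans (g _)).
  have -> : t + t = t * 2 by ring.
  rewrite exprMn.
  rewrite ler_wpM2r ?exprn_ge0 //= 2!exprS mulrA -expr2 ler_piMr ?exprn_ge0 //.
  by rewrite exprn_ile1.
Qed.

Lemma C_approx_step m : C_approx K m.+1 - C_approx K m =
  exp_w1 (- H1 K m) * (exp_w1 (- m.+1%:R^-1) * x_W m.+1%:R^-1 - 1) * P_ K m.
Proof.
rewrite !C_approxE H1S opprD exp_w1D /= mulrBr mulr1 mulrBl.
by rewrite !mulrA.
Qed.

Lemma C_approx_step_bound m (u : word) :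
  `|C_approx K m.+1 u - C_approx K m u| <=
  m.+1%:R ^- 2 * (4 * H1 K m.+1) ^+ size u.
Proof.
rewrite -[_ - _]/((C_approx K m.+1 - C_approx K m) u) C_approx_step.
set t : K := m.+1%:R^-1; set y := _ - 1.
have tp : 0 < t by rewrite invr_gt0 ltr0n.
have t2p : 0 < t ^+ 2 by rewrite exprn_gt0.
have t2n : `|t ^- 2| = t ^- 2 by rewrite ger0_norm // invr_ge0 ltW.
have gy : growth 2 (t ^- 2 *: y).
  move=> v; rewrite scaleWE normrM t2n.
  by rewrite ler_pdivrMl // local_factor_bound // invS_itv.
have gE : growth (H1 K m) (exp_w1 (- H1 K m)).
  by have := @growth_exp_w1 (- H1 K m); rewrite normrN ger0_norm ?H1_ge0.
have H0 := H1_ge0 K m; have HS1 := H1_ge1 K m.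
have HS : H1 K m <= H1 K m.+1 by rewrite H1S lerDl ltW.
have le4 : H1 K m + 2 + H1 K m <= 4 * H1 K m.+1.
  have -> : 4 * H1 K m.+1 =
      H1 K m.+1 + (H1 K m.+1 + H1 K m.+1) + H1 K m.+1 by ring.
  by rewrite -[2]/((1 + 1) : K) !lerD.
have ge0 : 0 <= H1 K m + 2 + H1 K m by rewrite !addr_ge0.
have := growth_le ge0 le4 (growthM (growthM gE gy) (growth_P m)).
rewrite -scalerAr -scalerAl => /(_ u); rewrite scaleWE normrM t2n.
by rewrite ler_pdivrMl // exprVn.
Qed.

End Growth.

(** * Convergence *)

Section Convergence.

Lemma exprS_diff_le (R : realDomainType) (x y : R) n : 0 <= y -> y <= x ->
  x ^+ n.+1 - y ^+ n.+1 <= n.+1%:R * (x - y) * x ^+ n.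
Proof.
move=> y0 yx; rewrite subrXX -mulrA mulrCA ler_wpM2l ?subr_ge0 //.
have x0 := le_trans y0 yx.
rewrite mulr_natl -[X in _ *+ X](card_ord n.+1) -sumr_const.
apply: ler_sum => i _ /=.
rewrite -[in leRHS](@subnK i n) -1?ltnS // exprD ler_wpM2l ?exprn_ge0 //.
by rewrite lerXn2r // nnegrE.
Qed.

Variable R : realType.

Definition hsum k N : R := \sum_(0 <= m < N) H1 R m.+1 ^+ k * m.+1%:R ^- 2.

Lemma invS_sqr_le m : m.+1%:R ^- 2 <= 2 * (m.+1%:R^-1 - m.+2%:R^-1) :> R.
Proof.
have n0 : 0 <= m%:R :> R by rewrite ler0n.
rewrite -(natr1 m.+1) -(natr1 m); set n : R := m%:R in n0 *.
rewrite -subr_ge0.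
have -> : 2 * ((n + 1)^-1 - (n + 1 + 1)^-1) - (n + 1) ^- 2 =
   n * (n + 1) ^- 2 * (n + 1 + 1)^-1 by field; lra.
by rewrite !mulr_ge0 ?invr_ge0 ?exprn_ge0 //; lra.
Qed.

Lemma hsum0_le N : hsum 0 N + 2 * N.+1%:R^-1 <= 2.
Proof.
elim: N => [|N IH]; first by rewrite /hsum big_geq // invr1 mulr1 add0r.
apply: le_trans IH; rewrite /hsum big_nat_recr //= expr0 mul1r -addrA lerD2l.
by rewrite -lerBrDr -mulrBr invS_sqr_le.
Qed.

(** Summation by parts: [1/M^2] is comparable with the increment of [-1/M],
    and the increment of [H_1^{k+1}] is at most [(k+1) H_1^k / M]. *)
Lemma hsum_rec k N :
  hsum k.+1 N + 2 * H1 R N ^+ k.+1 * N.+1%:R^-1 <= 2 * k.+1%:R * hsum k N.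
Proof.
elim: N => [|N IH].
  by rewrite /hsum !big_geq // H1_0 expr0n /= mulr0 mul0r mulr0 addr0.
rewrite /hsum !big_nat_recr //= mulrDr -/(hsum _ _) -/(hsum _ _).
have h0 := H1_ge0 R N.
have hS : H1 R N <= H1 R N.+1 by rewrite H1S lerDl invr_ge0 ler0n.
have := exprS_diff_le k h0 hS.
rewrite [in H1 R N.+1 - _]H1S [_ + _ - _]addrAC subrr add0r => D.
have t0 : 0 < N.+1%:R^-1 :> R by rewrite invr_gt0 ltr0n.
have X0 : 0 <= H1 R N.+1 ^+ k.+1 by rewrite exprn_ge0 ?H1_ge0.
set X := H1 R N.+1 ^+ k.+1 in X0 D *; set Y := H1 R N ^+ k.+1 in IH D *.
set Z := H1 R N.+1 ^+ k in D *.
have A := ler_wpM2l X0 (invS_sqr_le N).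
have B := ler_wpM2r (ltW t0) D.
rewrite -exprVn in A *; move: A B IH; set t := N.+1%:R^-1; set s := N.+2%:R^-1.
set a := hsum _ _; set b := hsum _ _; set c := k.+1%:R.
by move=> A B IH; lra.
Qed.

Lemma weighted_sum_bounded k : exists c, forall N, hsum k N <= c.
Proof.
elim: k => [|k [c hc]].
  exists 2 => N; apply: le_trans (hsum0_le N).
  by rewrite lerDl mulr_ge0 // invr_ge0.
exists (2 * k.+1%:R * c) => N.
apply: le_trans (_ : _ <= 2 * k.+1%:R * hsum k N) _; last first.
  by rewrite ler_wpM2l // mulr_ge0.
apply: le_trans (hsum_rec k N); rewrite lerDl.
by rewrite !mulr_ge0 ?exprn_ge0 ?H1_ge0 // invr_ge0.
Qed.

Lemma C_approx_is_cvg_real (u : word) : cvgn (fun m => C_approx R m u).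
Proof.
pose a m := C_approx R m u.
have aE : a = (fun n => a 0%N + series (telescope a) n).
  by apply/funext => n; rewrite -eq_sum_telescope.
rewrite -/a aE; apply: is_cvgD; first exact: is_cvg_cst.
apply: normed_cvg.
apply: (@series_le_cvg _ _
  (fun m => m.+1%:R ^- 2 * (4 * H1 R m.+1) ^+ size u)) => [m|m|m|].
- exact: normr_ge0.
- by rewrite mulr_ge0 ?invr_ge0 ?exprn_ge0 // mulr_ge0 // H1_ge0.
- exact: C_approx_step_bound.
apply: nondecreasing_is_cvgn.
  apply/nondecreasing_seqP => n; rewrite !seriesEnat /= big_nat_recr //= lerDl.
  by rewrite mulr_ge0 ?invr_ge0 ?exprn_ge0 // mulr_ge0 // H1_ge0.
have [c hc] := weighted_sum_bounded (size u).
exists (4 ^+ size u * c) => _ [n _ <-].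
rewrite seriesEnat /=.
apply: le_trans (_ : _ <= 4 ^+ size u * hsum (size u) n) _; last first.
  by rewrite ler_wpM2l ?exprn_ge0.
rewrite /hsum mulr_sumr; apply: ler_sum => m _.
by rewrite exprMn mulrC mulrA.
Qed.

End Convergence.

Section ScalarExtension.
Variables (K L : numFieldType) (f : {rmorphism K -> L}).

Lemma Wmul_map (x y : W K) (x' y' : W L) :
  (forall u, x' u = f (x u)) -> (forall u, y' u = f (y u)) ->
  forall u, (x' * y') u = f ((x * y) u).
Proof.
move=> hx hy u; rewrite !WmulE rmorph_sum; apply: eq_bigr => i _.
by rewrite hx hy rmorphM.
Qed.

(** The coefficients of [C_M] lie in the prime field; in particular the complex
    ones are the images of the real ones. *)
Lemma C_approx_map m u : C_approx L m u = f (C_approx K m u).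
Proof.
have hH n : H1 L n = f (H1 K n).
  by rewrite rmorph_sum; apply: eq_bigr => i _; rewrite fmorphV rmorph_nat.
rewrite !C_approxE; apply: Wmul_map => {}u.
  rewrite /exp_w1; case: all; last by rewrite rmorph0.
  by rewrite rmorphM fmorphV rmorph_nat rmorphXn rmorphN hH.
elim: m u => [|m IH] u.
  by rewrite -[RHS]/(f (u == [::])%:R) rmorph_nat.
apply: Wmul_map => // {}u; case: u => [|k [|l u]] /=; rewrite ?rmorph1 ?rmorph0 //.
by rewrite rmorphXn fmorphV rmorph_nat.
Qed.

End ScalarExtension.

Lemma real_complex_cvg (R : realType) (a : nat -> R) (l : R) :
  a @ \oo --> l ->
  (fun n => real_complex R (a n) : (R[i] : numFieldType)) @ \oo -->
    (real_complex R l : (R[i] : numFieldType)).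
Proof.
move=> /cvgrPdist_lt al; apply/cvgrPdist_lt => e; rewrite ltcE /= => /andP[/eqP e0 ep].
have {al} := al _ ep; apply: filterS => n h.
rewrite -rmorphB /= normc_def /= expr0n /= addr0 sqrtr_sqr ltcE /=.
by rewrite e0 eqxx.
Qed.

Lemma C_approx_cvg (R : realType) (u : word) :
  (fun m => C_approx (R[i] : numFieldType) m u) @ \oo -->
    C_star (R[i] : numFieldType) u.
Proof.
set a := (fun m => C_approx (R[i] : numFieldType) m u).
have aE : a = (fun m => real_complex R (C_approx R m u)).
  apply/funext => m.
  exact: (@C_approx_map R (R[i] : numFieldType) (real_complex R)).
have := real_complex_cvg (@C_approx_is_cvg_real R u).
rewrite -aE; set l := lim _ => al.
by have -> : C_star (R[i] : numFieldType) u = real_complex R l by exact: cvg_lim al.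
Qed.

(** * Group-like elements *)

Section Grouplike.
Variable K : fieldType.

(** The condition [Delta_* g = g (x) g] tested on pairs of modules, where it
    needs neither infinite sums nor completed tensor products. *)
Definition grouplike (g : W K) := forall M1 M2 : wmod K,
  rho (tmod M1 M2) g = tmap (rho M1 g) (rho M2 g).

Lemma grouplike1 : grouplike 1.
Proof. by move=> M1 M2; rewrite !rho1 tmap1. Qed.

Lemma grouplikeM g h : grouplike g -> grouplike h -> grouplike (g * h).
Proof. by move=> hg hh M1 M2; rewrite !rhoM hg hh tmap_comp. Qed.

Lemma high_le m n (x : W K) : (m <= n)%N -> high n x -> high m x.
Proof. by move=> mn hx u um; apply: hx; apply: leq_trans um mn. Qed.

Section Graded.
Variables (g : W K) (d : nat -> W K).
Hypothesis dE : forall n u, d n u = if wt u == n then g u else 0.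

Lemma component_high n : high n (d n).
Proof. by move=> u un; rewrite dE ltn_eqF. Qed.

Lemma rho_components (M : wmod K) N L : (forall x, high N x -> rho M x = 0) ->
  (N <= L)%N -> rho M g = \sum_(n < L) rho M (d n).
Proof.
move=> hN NL; rewrite -(lin_sum (rho_linear M)) /=.
set s := \sum_(n < L) d n.
have h : high N (g - s).
  apply: high_le NL _ => u uL; rewrite addWE oppWE /s sumWE.
  rewrite (bigD1 (Ordinal uL)) //= dE eqxx big1 ?addr0 ?subrr // => i ni.
  by rewrite dE; case: eqP => // e; case/eqP: ni; apply: val_inj.
by rewrite -[g](subrK s) (linD (rho_linear M)) hN // add0r.
Qed.

Hypothesis dD : forall (M1 M2 : wmod K) n, rho (tmod M1 M2) (d n) =
  \sum_(i < n.+1) tmap (rho M1 (d i)) (rho M2 (d (n - i)%N)).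

(** The hypothesis equates the components of [Delta_* g] and of [g (x) g] of
    each total weight; continuity makes both sums finite. *)
Lemma grouplike_divided_powers : grouplike g.
Proof.
move=> M1 M2; have [N1 h1] := rho_continuous M1.
have [N2 h2] := rho_continuous M2; have [N3 h3] := rho_continuous (tmod M1 M2).
pose N := (N1 + N2 + N3)%N.
rewrite (rho_components h3 (L := N.*2.+1)); last by rewrite /N; lia.
under eq_bigr do rewrite dD.
(* From total weight [n <= 2N] to pairs [i + j <= 2N]: all the pairs with
   [i, j < N] occur, and the others act by zero. *)
rewrite (sum_triangle (fun i j _ => tmap (rho M1 (d i)) (rho M2 (d j)))).
rewrite (rho_components h1 (L := N.*2.+1)); last by rewrite /N; lia.
rewrite (bilin_suml (tmap_bilin _ _ _ _)); apply: eq_bigr => i _.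
rewrite -(bilin_sumr (tmap_bilin _ _ _ _)).
case: (leqP N i) => iN.
  have N1i : (N1 <= i)%N by apply: leq_trans iN; rewrite /N; lia.
  have -> : rho M1 (d i) = 0 by apply: h1; exact: high_le N1i (@component_high i).
  by rewrite !(bilin0l (tmap_bilin _ _ _ _)).
rewrite (rho_components h2 (L := (N.*2 - i).+1)) //.
by rewrite /N in iN *; lia.
Qed.
End Graded.

End Grouplike.

Section GrouplikeExamples.
Variable K : numFieldType.

Lemma grouplike_x_W (t : K) : grouplike (x_W t).
Proof.
apply: (@grouplike_divided_powers _ _ (fun n => t ^+ n *: w_ K n)).
  move=> n u; rewrite scaleWE /w_ /mon; case: n u => [|n] [|k [|l u]] //=.
  - by rewrite mulr1.
  - by rewrite mulr0.
  - by rewrite mulr0 ?if_same.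
  - by rewrite mulr0.
  - rewrite /wt /= addn0 eqseq_cons andbT eqSS.
    by case: eqP => [->|_]; rewrite ?mulr1 ?mulr0.
  - by rewrite eqseq_cons andbF mulr0 ?if_same.
move=> M1 M2 n; rewrite (linZ (rho_linear _)) tmod_w scaler_sumr.
apply: eq_bigr => i _; rewrite !(linZ (rho_linear _)).
rewrite (bilinZl (tmap_bilin _ _ _ _)) (bilinZr (tmap_bilin _ _ _ _)) scalerA.
by rewrite -exprD subnKC // -ltnS.
Qed.

Definition dpow (c : K) n : W K := (c ^+ n / n`!%:R) *: mon K (nseq n 0%N).

Lemma dpowS c n : n.+1%:R *: dpow c n.+1 = (c *: w_ K 1) * dpow c n.
Proof.
rewrite /dpow -scalerAl -scalerAr /w_ monM /= !scalerA; congr (_ *: _).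
have n0 : n.+1%:R != 0 :> K by rewrite pnatr_eq0.
have f0 : n`!%:R != 0 :> K by rewrite pnatr_eq0 -lt0n fact_gt0.
rewrite factS natrM exprS; move: (_.+1%:R) (_`!%:R) n0 f0 => p q p0 q0.
by field; rewrite p0 q0.
Qed.

(** Since [w_1] is primitive, [Delta_* (n+1) d_{n+1}] is the product of
    [c (1 (x) w_1 + w_1 (x) 1)] and [Delta_* d_n]; each term [d_i (x) d_j] with
    [i + j = n + 1] then arises with multiplicity [j] from the first summand
    and [i] from the second. *)
Lemma dpow_coprod c (M1 M2 : wmod K) n : rho (tmod M1 M2) (dpow c n) =
  \sum_(i < n.+1) tmap (rho M1 (dpow c i)) (rho M2 (dpow c (n - i)%N)).
Proof.
elim: n => [|n IH].
  have d0 : dpow c 0 = 1 by rewrite /dpow expr0 divr1 scale1r.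
  by rewrite big_ord_recl big_ord0 addr0 subn0 d0 !rho1 tmap1.
have rS (M : wmod K) i :
   (rho M (c *: w_ K 1) \o rho M (dpow c i))%VF = i.+1%:R *: rho M (dpow c i.+1).
  by rewrite -rhoM -dpowS (linZ (rho_linear _)).
have n0 : n.+1%:R != 0 :> K by rewrite pnatr_eq0.
have bl := tmap_bilin M1 M1 M2 M2.
have w1E : rho (tmod M1 M2) (c *: w_ K 1) =
    tmap \1%VF (rho M2 (c *: w_ K 1)) + tmap (rho M1 (c *: w_ K 1)) \1%VF.
  rewrite !(linZ (rho_linear _)) tmod_w /tD !big_ord_recl big_ord0 addr0 /=.
  by rewrite subn0 subnn !rho1 scalerDr (bilinZr bl) (bilinZl bl).
apply: (scalerI n0); rewrite -rS // IH w1E comp_lfunDl !comp_sumr.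
pose T i := tmap (rho M1 (dpow c i)) (rho M2 (dpow c (n.+1 - i)%N)).
transitivity (\sum_(i < n.+2) (n.+1 - i)%:R *: T i +
              \sum_(i < n.+2) i%:R *: T i).
  rewrite [X in _ = X + _]big_ord_recr /= subnn scale0r addr0.
  rewrite [X in _ = _ + X]big_ord_recl /= scale0r add0r /T.
  congr (_ + _); apply: eq_bigr => i _.
    have ile : (i <= n)%N by rewrite -ltnS.
    by rewrite -tmap_comp comp_lfun1l rS // subSn // (bilinZr bl).
  by rewrite -tmap_comp comp_lfun1l rS // (bilinZl bl) subSS.
rewrite -big_split scaler_sumr; apply: eq_bigr => i _ /=.
by rewrite -scalerDl -natrD subnK // -ltnS.
Qed.

Lemma dpowE c n (u : word) : dpow c n u = if wt u == n then exp_w1 c u else 0.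
Proof.
rewrite /dpow scaleWE /mon all_pred1_size /exp_w1.
case: (boolP (all _ u)) => [/all_pred1P u0|]; last by rewrite andbF mulr0 if_same.
have -> : wt u = size u.
  by rewrite u0 /wt map_nseq sumn_nseq mul1n !size_nseq.
by case: eqP => [->|_]; rewrite ?mulr1 ?mulr0.
Qed.

Lemma grouplike_exp_w1 (c : K) : grouplike (exp_w1 c).
Proof. exact: grouplike_divided_powers (dpowE c) (dpow_coprod c). Qed.

Lemma grouplike_C_approx m : grouplike (C_approx K m).
Proof.
rewrite C_approxE; apply: grouplikeM; first exact: grouplike_exp_w1.
elim: m => [|m IH]; first exact: grouplike1.
by apply: grouplikeM IH; exact: grouplike_x_W.
Qed.

End GrouplikeExamples.

(** * Horizontal transport *)

Section CoordinateLimits.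
Variables (K : numFieldType) (V : vectType K).
Implicit Types (s : nat -> V) (l : V).

Lemma vcvg_vlim s l : vcvg s l -> vlim s = l.
Proof.
move=> sl; rewrite [RHS](coord_vbasis (memvf l)); apply: eq_bigr => i _.
by congr (_ *: _); apply: cvg_lim (sl i).
Qed.

Lemma vcvg_unique s l l' : vcvg s l -> vcvg s l' -> l = l'.
Proof. by move=> /vcvg_vlim <- /vcvg_vlim. Qed.

Lemma vcvg_near_cst s l : (\forall n \near \oo, s n = l) -> vcvg s l.
Proof. by move=> h i; apply: cvg_near_cst; apply: filterS h => n ->. Qed.

Lemma vcvg_sumZ (I : Type) (r : seq I) (a : nat -> I -> K) (b : I -> K) (w : I -> V) :
  (forall i, (fun n => a n i) @ \oo --> b i) ->
  vcvg (fun n => \sum_(i <- r) a n i *: w i) (\sum_(i <- r) b i *: w i).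
Proof.
move=> ab k; elim: r => [|i r IH].
  have -> : (fun n => coord (vbasis {:V}) k (\sum_(i <- [::]) a n i *: w i)) =
      cst (coord (vbasis {:V}) k (\sum_(i <- [::]) b i *: w i)).
    by apply/funext => n; rewrite !big_nil.
  exact: cvg_cst.
have E (c : I -> K) : coord (vbasis {:V}) k (\sum_(j <- i :: r) c j *: w j) =
    c i * coord (vbasis {:V}) k (w i) + coord (vbasis {:V}) k (\sum_(j <- r) c j *: w j).
  by rewrite big_cons linearD linearZ.
rewrite E; under eq_fun do rewrite E.
by apply: cvgD => //; apply: cvgM (cvg_cst _); exact: ab.
Qed.

End CoordinateLimits.

Section LimitsInW.
Variables (K : numFieldType) (g : nat -> W K) (g0 : W K).
Hypothesis gg0 : forall u, (fun n => g n u) @ \oo --> g0 u.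

(** Only the finitely many coefficients of small weight act on [M]. *)
Lemma rho_cvg (M : wmod K) v : vcvg (fun n => rho M (g n) v) (rho M g0 v).
Proof.
have [N hN] := rho_continuous M.
have E x : rho M x v = \sum_(u <- words_below N) x u *: rho M (mon K u) v.
  rewrite (rho_trunc _ hN) sum_lfunE; apply: eq_bigr => u _.
  by rewrite scale_lfunE.
by rewrite E; under eq_fun do rewrite E; exact: vcvg_sumZ.
Qed.

(** On given modules, both sides of the identity are polynomials in finitely
    many coefficients of [g]. *)
Lemma grouplike_lim : (forall n, grouplike (g n)) -> grouplike g0.
Proof.
move=> gl M1 M2; apply/lfunP => t; apply: vcvg_unique (@rho_cvg (tmod M1 M2) t) _.
have [N1 h1] := rho_continuous M1; have [N2 h2] := rho_continuous M2.
have bl := tmap_bilin M1 M1 M2 M2.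
have E x : tmap (rho M1 x) (rho M2 x) t =
    \sum_(p <- [seq (u, v) | u <- words_below N1, v <- words_below N2])
      (x p.1 * x p.2) *: tmap (rho M1 (mon K p.1)) (rho M2 (mon K p.2)) t.
  rewrite (rho_trunc _ h1) (rho_trunc _ h2) (bilin_suml bl) sum_lfunE.
  rewrite big_allpairs_dep; apply: eq_bigr => u _ /=.
  rewrite (bilin_sumr bl) sum_lfunE; apply: eq_bigr => v _.
  by rewrite (bilinZl bl) (bilinZr bl) scalerA scale_lfunE.
rewrite E; under eq_fun do rewrite gl E.
by apply: vcvg_sumZ => p; apply: cvgM; exact: gg0.
Qed.
End LimitsInW.

(** Modulo high weight, [g] is [1 - z] with [z] nilpotent, and the geometric
    series terminates. *)
Lemma rho_unipotent_iso (K : fieldType) (g : W K) (M : wmod K) : g [::] = 1 ->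
  is_iso (D := Vect K) (rho M g).
Proof.
move=> g1; have [N hN] := rho_continuous M.
have zhigh n : high n ((1 - g) ^+ n).
  have z0 : (1 - g) [::] = 0 by rewrite addWE oppWE g1 W1_nil subrr.
  elim: n => [|n IH] // u un; rewrite exprS WmulE big1 // => -[i /= _] _.
  case: i => [|i]; first by rewrite take0 z0 mul0r.
  case: u un => [|a u] un /=; first by rewrite z0 mul0r.
  rewrite IH ?mulr0 //; move: un.
  rewrite -{1}(cat_take_drop i u) -cat_cons wt_cat /wt /=; lia.
pose s := \sum_(i < N) (1 - g) ^+ i.
have e1 : 1 - g * s = (1 - g) ^+ N.
  have := subrX1 (1 - g) N; rewrite -/s addrAC subrr add0r mulNr => h.
  by rewrite -[RHS](subrK 1) h addrC.
have e2 : s * g = g * s.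
  rewrite /s mulr_suml mulr_sumr; apply: eq_bigr => i _.
  by symmetry; apply: commrX; apply: commrB; [exact: commr1 | exact: commr_refl].
have gs : rho M (g * s) = \1%VF.
  have : rho M (1 - g * s) = 0 by rewrite e1 hN.
  rewrite -scaleN1r addrC (rho_linear M) rho1 scaleN1r addrC => /eqP.
  by rewrite subr_eq0 => /eqP.
by exists (rho M s); split; rewrite /= -rhoM ?e2.
Qed.

Section Transport.
Variable K : numFieldType.

Lemma expE_w1 (M : wmod K) c v : expE (c *: rho M (w_ K 1)) v = rho M (exp_w1 c) v.
Proof.
apply: vcvg_vlim; apply: vcvg_near_cst.
have [N hN] := rho_continuous M; near=> n.
have Nn : (N <= n)%N by near: n; exact: nbhs_infty_ge.
rewrite (rho_components (dpowE c) hN Nn) sum_lfunE; apply: eq_bigr => k _.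
rewrite /dpow mulrC -scalerA (linZ (rho_linear M)) scale_lfunE; congr (_ *: _).
elim: {k}(k : nat) => [|k IH] /=; first by rewrite scale1r rho1 id_lfunE.
have -> : c ^+ k.+1 *: mon K (0%N :: nseq k 0%N) =
    (c *: w_ K 1) * (c ^+ k *: mon K (nseq k 0%N)).
  by rewrite -scalerAl -scalerAr scalerA -exprS /w_ monM.
by rewrite IH rhoM comp_lfunE [rho M (c *: w_ K 1)](linZ (rho_linear M)).
Unshelve. all: by end_near.
Qed.

Section Module.
Variable M : wmod K.

Fact P_sol (v : M) : is_sol (fun k => rho M (P_ K k) v).
Proof. by apply/asboolP => k; rewrite /= rhoM comp_lfunE. Qed.

Definition sol_of (v : M) : Sol M := MkSol (P_sol v).

Lemma ev_1K : cancel (@ev_1 K M) sol_of.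
Proof.
case=> Y hY; apply: val_inj; apply/funext => k /=; rewrite /ev_1 /=.
elim: k => [|k IH]; first by rewrite rho1 id_lfunE.
by rewrite rhoM comp_lfunE IH; move/asboolP: hY => ->.
Qed.

Lemma sol_ofK : cancel sol_of (@ev_1 K M).
Proof. by move=> v; rewrite /ev_1 /= rho1 id_lfunE. Qed.

Lemma lc_seq_sol_of v m : lc_seq (sol_of v) m = rho M (C_approx K m) v.
Proof. by rewrite /lc_seq expE_w1 C_approxE rhoM comp_lfunE. Qed.

Hypothesis C_cvg : forall u, (fun m => C_approx K m u) @ \oo --> C_star K u.

Lemma lc_oo_sol_of v :
  vcvg (lc_seq (sol_of v)) (lc_oo (sol_of v)) /\ T_hor M v = lc_oo (sol_of v).
Proof.
have h : vcvg (lc_seq (sol_of v)) (rho M (C_star K) v).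
  by rewrite (funext (lc_seq_sol_of v)); exact: rho_cvg.
by rewrite /lc_oo (vcvg_vlim h).
Qed.
End Module.

Lemma C_star_nil (C_cvg : forall u, (fun m => C_approx K m u) @ \oo --> C_star K u) :
  C_star K [::] = 1.
Proof.
suff E m : C_approx K m [::] = 1.
  have := C_cvg [::]; rewrite (funext E) => /(cvg_lim (@norm_hausdorff _ _)) <-.
  exact: lim_cst.
rewrite C_approxE WM_nil [exp_w1 _ _]/exp_w1 /= expr0 divr1 mul1r.
elim: m => [|m IH]; first exact: W1_nil.
by rewrite [P_ _ _]/= WM_nil IH mulr1.
Qed.

Lemma grouplike_tensor_iso p q (g : W K) : grouplike g -> g [::] = 1 ->
  is_tensor_iso (F := omega K p) (G := omega K q) (fun M : C_W K => rho M g).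
Proof.
move=> gl g1; split.
- by move=> A B f; apply/lfunP => v; rewrite /= !comp_lfunE whomP.
- by move=> A; exact: rho_unipotent_iso.
- by move=> A B; rewrite [LHS]comp_lfun1r [RHS]comp_lfun1l; exact: gl.
- by rewrite /= /urho g1 scale1r comp_lfun1l.
Qed.
End Transport.

Theorem proposition9 (R : realType) :
  let C := R[i] : numFieldType in
  [/\ is_fiber_functor (omega_1 C) /\ is_fiber_functor (omega_oo C),
      (* the limit defining C_* exists weight by weight *)
      forall u : word, (fun m => C_approx C m u) @ \oo --> C_star C u,
      is_tensor_iso (F := omega_1 C) (G := omega_oo C) (@T_alg C) /\
      (forall V : C_W C, (triv at_oo V \o T_alg V)%VF = triv at_1 V),
      is_tensor_iso (F := omega_1 C) (G := omega_oo C) (@T_hor C) /\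
      (forall V : C_W C, exists2 ev_1_inv : fiber at_1 V -> Sol V,
         cancel (@ev_1 C V) ev_1_inv /\ cancel ev_1_inv (@ev_1 C V) &
         forall v : fiber at_1 V,
           vcvg (lc_seq (ev_1_inv v)) (lc_oo (ev_1_inv v)) /\
           T_hor V v = lc_oo (ev_1_inv v))
    & forall T_alg_inv : forall V : C_W C, 'Hom(fiber at_oo V, fiber at_1 V),
        (forall V : C_W C, inverse_of (C := Vect C) (T_alg V) (T_alg_inv V)) ->
        let ratio (V : C_W C) := (T_alg_inv V \o T_hor V)%VF in
        is_tensor_iso (F := omega_1 C) (G := omega_1 C) ratio /\
        (forall V : C_W C, ratio V = represented_by (C_star C) V)].
Proof.
move=> C.
have C_cvg u : (fun m => C_approx C m u) @ \oo --> C_star C u by exact: C_approx_cvg.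
have C_gl : grouplike (C_star C).
  by apply: (grouplike_lim C_cvg) => m; exact: grouplike_C_approx.
have C_1 := C_star_nil C_cvg.
split=> //.
- by split; exact: omega_fiber_functor.
- split; last by move=> V; exact: comp_lfun1l.
  have -> : @T_alg C = fun M : C_W C => rho M 1.
    by apply/functional_extensionality_dep => M; rewrite rho1.
  by apply: grouplike_tensor_iso; [exact: grouplike1 | exact: W1_nil].
- split; first exact: grouplike_tensor_iso.
  move=> V; exists (@sol_of C V); first by split; [exact: ev_1K | exact: sol_ofK].
  by move=> v; exact: lc_oo_sol_of.
- move=> S hS ratio.
  have ratioE V : ratio V = rho V (C_star C).
    have [/= SV _] := hS V; rewrite /T_alg comp_lfun1r in SV.
    by rewrite /ratio SV comp_lfun1l.
  split; last exact: ratioE.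
  have -> : ratio = fun M : C_W C => rho M (C_star C).
    by apply/functional_extensionality_dep => V; exact: ratioE.
  exact: grouplike_tensor_iso.
Qed.
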